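(* Work in the setting described in the context. Let $0<\Delta t\le1$, $0<\varepsilon\le1$, $0\le n<N_{\Delta t}$, and let $\phi$ be smooth on $[t_n,t_{n+1}]\times O_\varepsilon$, where $O_\varepsilon=\{x\in O:\operatorname{dist}(x,\partial O)>\varepsilon\}$. Assume that, with all norms taken over $[t_n,t_{n+1}]\times O_\varepsilon$, $$\|\phi\|_\infty\le C_{\rm reg},\qquad \|D_x^\alpha\partial_t^q\phi\|_\infty\le C_{\rm reg}\,\varepsilon^{1-|\alpha|-2q},\qquad 1\le|\alpha|+2q\le6,$$ with $C_{\rm reg}$ independent of $\varepsilon,h,\Delta t$ and the control. Assume that the node $x_i\in G_h\cap O$ satisfies $$\operatorname{dist}(x_i,\partial O)\ge2\varepsilon+B_{\mathcal C}\sqrt{\Delta t}+C_{\rm patch}h .$$ Then, for every control $a\in A$ and every signed cubature direction $(j,\pm)$, $$d^{a,j,\pm}_{n,i}=\Delta t,\qquad\tau_{n,i}(a)=\Delta t,\qquad\omega^{a,j,\pm}_{n,i}=\frac{\rho_j}2,$$ and every point used for interpolation is at least $2\varepsilon$ from $\partial O$, and hence belongs to $O_\varepsilon$. Let $\phi_h^{n+1}:G_h\to\mathbb R$ be any grid vector that agrees with $\phi(t_{n+1},\cdot)$ at every interpolation vertex used by these full-step branches. Then, uniformly in $a$, $$\bigl|\mathcal R^a_{h,n,i}[\phi(t_n,x_i),\phi_h^{n+1}]-F^a[\phi](t_n,x_i)\bigr|\le C\Bigl(\Delta t\,\varepsilon^{-3}+\Delta t^2\varepsilon^{-5}+\frac{h^2}{\Delta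 t}\varepsilon^{-1}\Bigr).$$ Consequently, $$\bigl|\mathcal S_{h,n,i}[\phi(t_n,x_i),\phi_h^{n+1}]-\inf_{a\in A}F^a[\phi](t_n,x_i)\bigr|\le C\Bigl(\Delta t\,\varepsilon^{-3}+\Delta t^2\varepsilon^{-5}+\frac{h^2}{\Delta t}\varepsilon^{-1}\Bigr).$$ The constant $C$ is independent of $h,\Delta t,\varepsilon,n,i$ and $a$.
   Context: **Data.** $N,p\ge1$ are integers, $O\subset\mathbb R^N$ is a bounded domain, $T>0$. $|\cdot|$ is the absolute value, Euclidean norm or Frobenius norm. $(A,d_A)$ is a nonempty compact metric space; $\sigma(t,x,a)\in\mathbb R^{N\times p}$, $\mu(t,x,a)\in\mathbb R^N$, $r(t,x,a),f(t,x,a)\in\mathbb R$ are defined on $[0,T]\times\overline O\times A$; $\Psi:\overline O\to\mathbb R$; $u_\partial:[0,T]\times\partial O\to\mathbb R$. Write $g^a(t,x)=g(t,x,a)$, $A^a=\sigma^a(\sigma^a)^\top$, and $$F^a[\varphi]=\partial_t\varphi+\tfrac12\operatorname{Tr}(A^aD^2\varphi)+\mu^a\cdot D\varphi-r^a\varphi+f^a .$$ Assumption: there is $K_0>0$ with $\|\Psi\|_\infty+\|u_\partial\|_\infty+\sup_a(\|\sigma^a\|_\infty+\|\mu^a\|_\infty+\|r^a\|_\infty+\|f^a\|_\infty)\le K_0$; $|\Psi(x)-\Psi(y)|\le K_0|x-y|$; $|u_\partial(t,x)-u_\partial(s,y)|\le K_0(|x-y|+|t-s|^{1/2})$ on $[0,T]\times\partial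 O$; for each $g\in\{\sigma,\mu,r,f\}$, $|g(t,x,a)-g(s,y,a)|\le K_0(|x-y|+|t-s|^{1/2})$ on $[0,T]\times\overline O$ for each $a$; for each fixed $(t,x)$ the coefficients are continuous in $a$. Also $r\ge0$. **Cubature.** Fixed $M\ge1$, $\eta_j\in\mathbb R^p\setminus\{0\}$, $\rho_j>0$ ($1\le j\le M$) with $\sum_j\rho_j=1$, $\sum_j\rho_j\eta_j\eta_j^\top=I_p$, independent of mesh and control. Put $$B_{\mathcal C}=1+\sup_{(t,x,a)\in[0,T]\times\overline O\times A,\ 1\le j\le M}\bigl(|\mu(t,x,a)|+|\sigma(t,x,a)\eta_j|\bigr).$$ **Mesh.** $O_h$ is a polyhedral approximation of $O$, $\mathcal T_h$ a simplicial triangulation of $O_h$ with vertex set $G_h=\{x_i:1\le i\le N_h\}$, $h=\max_{E\in\mathcal T_h}\operatorname{diam}E$, $\psi_i$ the $P_1$ nodal basis; $N_{\Delta t}\in\mathbb N$, $\Delta t=T/N_{\Delta t}$, $t_n=n\Delta t$. Constants $C_\partial,C_p,C_{\rm patch}$ do not depend on $h$. (G1) $G_h\cap\partial O_h=G_h\cap\partial O$ and all other vertices lie in $O$. (G2) Every boundary element has at most one face in $\partial O_h$. (G3) $\mathcal T_h$ is conforming with nondegenerate simplices. (G4) $d_H(\partial O,\partial O_h)\le C_\partial h^2$ (Hausdorff distance); there is a map $p_h:\overline O\to\overline O_h$ with $p_h(x_i)=x_i$, $\sup_x|p_h(x)-x|\le C_ph^2$; and with $\mathcal X_h\subset O$ the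 set of off-grid branch endpoints at which the scheme below evaluates $I^{\mathrm{sp}}$, for every $x\in\mathcal X_h$ and $\ell$ with $\psi_\ell(p_h(x))>0$ (these $x_\ell$ are the interpolation vertices used at $x$): $|x_\ell-x|\le C_{\rm patch}h$, $[x,x_\ell]\subset\overline O$, $[x,x_\ell)\subset O$. Interpolation: $I^{\mathrm{sp}}[\Phi](x)=\sum_i\psi_i(p_h(x))\Phi(x_i)$. ''Points used for interpolation'' in the row $(n,i)$ are the full-step branch endpoints and the interpolation vertices used at them. **Scheme rows.** For $x_i\in G_h\cap O$, $n<N_{\Delta t}$, $a\in A$, let $\Gamma^{a,j,\pm}_{n,i}(q)=x_i+q\mu(t_n,x_i,a)\pm\sqrt q\,\sigma(t_n,x_i,a)\eta_j$, $0\le q\le\Delta t$. If $\{q\in(0,\Delta t]:\Gamma^{a,j,\pm}_{n,i}(q)\notin O\}$ is nonempty, $d^{a,j,\pm}_{n,i}=d_j^\pm$ is its infimum and $\chi_j^\pm=1$; otherwise $d_j^\pm=\Delta t$, $\chi_j^\pm=0$. Put $s_j^\pm=\sqrt{d_j^\pm}$, $\theta_j=s_j^+s_j^-$, $\tau_{n,i}(a)=(\sum_j\rho_j/\theta_j)^{-1}$, $\omega^{a,j,\pm}_{n,i}=\omega_j^\pm=\tau_{n,i}(a)\rho_j/\bigl(s_j^\pm(s_j^++s_j^-)\bigr)$. For $\Phi:G_h\to\mathbb R$ let $C_j^\pm[\Phi]=I^{\mathrm{sp}}[\Phi](\Gamma^{a,j,\pm}_{n,i}(\Delta t))$ if $\chi_j^\pm=0$;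 $=\Psi(\Gamma^{a,j,\pm}_{n,i}(d_j^\pm))$ if $\chi_j^\pm=1$, $t_n+d_j^\pm=T$; $=u_\partial(t_n+d_j^\pm,\Gamma^{a,j,\pm}_{n,i}(d_j^\pm))$ if $\chi_j^\pm=1$, $t_n+d_j^\pm<T$. Then $$S^a_{n,i}[\Phi]=\sum_{j,\pm}\omega_j^\pm\Bigl(\frac{C_j^\pm[\Phi]}{1+r(t_n,x_i,a)d_j^\pm}+f(t_n,x_i,a)d_j^\pm\Bigr).$$ **Residuals.** $\mathcal R^a_{h,n,i}[U_i^n,U^{n+1}]=\bigl(S^a_{n,i}[U^{n+1}]-U_i^n\bigr)/\tau_{n,i}(a)$ and $\mathcal S_{h,n,i}[U_i^n,U^{n+1}]=\inf_{a\in A}\mathcal R^a_{h,n,i}[U_i^n,U^{n+1}]$. *)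

(* Defs.v *)
From HB Require Import structures.
From mathcomp Require Import all_boot all_order all_algebra.
From mathcomp Require Import all_classical all_reals all_analysis.
Set Implicit Arguments.
Unset Strict Implicit.
Unset Printing Implicit Defensive.
Import Order.TTheory GRing.Theory Num.Theory.
Import numFieldNormedType.Exports.
Local Open Scope classical_set_scope.
Local Open Scope ring_scope.

(* Euclidean norm of a vector, Frobenius norm of a matrix. The library norm on
   matrices is the max norm; it is only used through the topology it induces. *)
Definition enorm (R : realType) (m n : nat) (B : 'M[R]_(m, n)) : R :=
  Num.sqrt (\sum_i \sum_j B i j ^+ 2).

Section Euclidean.
Context {R : realType} {N : nat}.
Implicit Types (S D : set 'cV[R]_N) (x : 'cV[R]_N).

Definition bd S : set 'cV[R]_N := closure S `\` interior S.

(* +oo when S is empty *)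
Definition dist x S : \bar R :=
  ereal_inf [set (enorm (x - y))%:E | y in S].

Definition hausdorff_dist S D : \bar R :=
  maxe (ereal_sup [set dist x D | x in S]) (ereal_sup [set dist y S | y in D]).

Definition diam S : R := sup [set enorm (z.1 - z.2) | z in S `*` S].

Definition inner S (eps : R) : set 'cV[R]_N :=
  [set x | S x /\ (eps%:E < dist x (bd S))%E].

Definition dotv (x y : 'cV[R]_N) : R := \sum_k x k ord0 * y k ord0.

(* In the next two definitions nrm is the norm of the target V. *)
Definition half_holder (V : zmodType) (nrm : V -> R) (I : set R) S
    (g : R -> 'cV[R]_N -> V) (K : R) : Prop :=
  forall t s x y, I t -> I s -> S x -> S y ->
    nrm (g t x - g s y) <= K * (enorm (x - y) + Num.sqrt `|t - s|).

Definition sup_norm (V : zmodType) (nrm : V -> R) (I : set R) S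
    (g : R -> 'cV[R]_N -> V) : \bar R :=
  ereal_sup [set (nrm (g z.1 z.2))%:E | z in I `*` S].

End Euclidean.

Section TestFunctions.
Context {R : realType} {N : nat}.
Implicit Types (I : set R) (U : set 'cV[R]_N) (phi : R -> 'cV[R]_N -> R).

(* Difference quotients in time are restricted to I, so that the derivative is
   one-sided at the end points of a closed interval. *)
Definition time_quot phi (t : R) (x : 'cV[R]_N) : R -> R :=
  fun s => (phi s x - phi t x) / (s - t).

Definition unit_vec (k : 'I_N) : 'cV[R]_N := delta_mx k ord0.

(* A direction is None for time and Some k for the k-th space coordinate. *)
Definition partial I (d : option 'I_N) phi : R -> 'cV[R]_N -> R :=
  fun t x => match d with
  | None => lim (time_quot phi t x @ within I (t^'))
  | Some k => 'D_(unit_vec k) (phi t) x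
  end.

Definition has_partial I (d : option 'I_N) phi (t : R) (x : 'cV[R]_N) : Prop :=
  match d with
  | None => cvg (time_quot phi t x @ within I (t^'))
  | Some k => derivable (phi t) x (unit_vec k)
  end.

(* The last direction of the word is differentiated first. *)
Definition partials I (w : seq (option 'I_N)) phi := foldr (partial I) phi w.

Definition smooth I U phi : Prop := forall w : seq (option 'I_N),
  (forall d t x, I t -> U x -> has_partial I d (partials I w phi) t x) /\
  {within I `*` U, continuous (fun z => partials I w phi z.1 z.2)}.

Definition msize (alpha : {ffun 'I_N -> nat}) : nat := (\sum_k alpha k)%N.

Definition Dxt I (alpha : {ffun 'I_N -> nat}) (q : nat) phi :=
  partials I
    (flatten [seq nseq (alpha k) (Some k) | k <- enum 'I_N] ++ nseq q None) phi.

Definition grad I phi t x : 'cV[R]_N :=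
  \col_k partial I (Some k) phi t x.

Definition hess I phi t x : 'M[R]_N :=
  \matrix_(k, l) partials I [:: Some k; Some l] phi t x.

End TestFunctions.

Section Data.
Context {R : realType} {N p : nat} {A : metricType R}.

Record problem := Problem {
  dom : set 'cV[R]_N;
  horizon : R;
  sigma : R -> 'cV[R]_N -> A -> 'M[R]_(N, p);
  mu : R -> 'cV[R]_N -> A -> 'cV[R]_N;
  rate : R -> 'cV[R]_N -> A -> R;
  source : R -> 'cV[R]_N -> A -> R;
  Psi : 'cV[R]_N -> R;
  u_bd : R -> 'cV[R]_N -> R
}.

Implicit Types P : problem.

Definition times P : set R := `[0, horizon P]%classic.

Definition coef_sup P (a : A) : \bar R :=
  let I := times P in let S := closure (dom P) in
  (sup_norm (@enorm R N p) I S (fun t x => sigma P t x a)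
   + sup_norm (@enorm R N 1) I S (fun t x => mu P t x a)
   + sup_norm Num.norm I S (fun t x => rate P t x a)
   + sup_norm Num.norm I S (fun t x => source P t x a))%E.

Record problem_ok P (K0 : R) : Prop := {
  ok_dom : [/\ open (dom P), connected (dom P), dom P !=set0
             & bounded_set (dom P)];
  ok_horizon : 0 < horizon P;
  ok_A : compact [set: A] /\ [set: A] !=set0;
  ok_K0 : 0 < K0;
  ok_bound :
    (ereal_sup [set (`|Psi P x|)%:E | x in closure (dom P)]
     + sup_norm Num.norm (times P) (bd (dom P)) (u_bd P)
     + ereal_sup (range (coef_sup P)) <= K0%:E)%E;
  ok_Psi : forall x y, closure (dom P) x -> closure (dom P) y ->
    `|Psi P x - Psi P y| <= K0 * enorm (x - y);
  ok_u_bd : half_holder Num.norm (times P) (bd (dom P)) (u_bd P) K0;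
  ok_sigma : forall a,
    half_holder (@enorm R N p) (times P) (closure (dom P))
      (fun t x => sigma P t x a) K0;
  ok_mu : forall a,
    half_holder (@enorm R N 1) (times P) (closure (dom P))
      (fun t x => mu P t x a) K0;
  ok_rate : forall a,
    half_holder Num.norm (times P) (closure (dom P))
      (fun t x => rate P t x a) K0;
  ok_source : forall a,
    half_holder Num.norm (times P) (closure (dom P))
      (fun t x => source P t x a) K0;
  ok_cont : forall t x, times P t -> closure (dom P) x ->
    [/\ continuous (sigma P t x), continuous (mu P t x),
        continuous (rate P t x) & continuous (source P t x)];
  ok_rate_ge0 : forall t x a, times P t -> closure (dom P) x ->
    0 <= rate P t x a
}.

(* I is the time interval on which phi is considered: the time derivative is
   one-sided at its end points. *)
Definition Fop P (I : set R) (a : A) (phi : R -> 'cV[R]_N -> R)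
    (t : R) (x : 'cV[R]_N) : R :=
  partial I None phi t x
  + 2^-1 * \tr (sigma P t x a *m (sigma P t x a)^T *m hess I phi t x)
  + dotv (mu P t x a) (grad I phi t x)
  - rate P t x a * phi t x + source P t x a.

End Data.

Arguments problem R N p A : clear implicits.

Section Cubature.
Context {R : realType} {p M : nat}.

Record cubature := Cubature {
  eta : 'I_M -> 'cV[R]_p;
  rho : 'I_M -> R
}.

Record cubature_ok (Q : cubature) : Prop := {
  eta_neq0 : forall j, eta Q j != 0;
  rho_gt0 : forall j, 0 < rho Q j;
  rho_sum : \sum_j rho Q j = 1;
  eta_cov : \sum_j rho Q j *: (eta Q j *m (eta Q j)^T) = 1%:M
}.

End Cubature.

Arguments cubature R p M : clear implicits.

Definition BC (R : realType) (N p M : nat) (A : metricType R)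
    (P : problem R N p A) (Q : cubature R p M) : R :=
  1 + sup [set y | exists t x a j, [/\ times P t, closure (dom P) x
    & y = enorm (mu P t x a) + enorm (sigma P t x a *m eta Q j)]].

Section Mesh.
Context {R : realType} {N : nat}.

(* A simplex is encoded by the set of indices of its vertices. *)
Record mesh := Mesh {
  nv : nat;
  vtx : 'I_nv -> 'cV[R]_N;
  elts : {set {set 'I_nv}};
  psi : 'I_nv -> 'cV[R]_N -> R;
  ph : 'cV[R]_N -> 'cV[R]_N
}.

Implicit Types m : mesh.

(* convex hull of the vertices indexed by E, empty if E is *)
Definition hull m (E : {set 'I_(nv m)}) : set 'cV[R]_N :=
  [set y | exists lam : 'I_(nv m) -> R,
    [/\ forall k, 0 <= lam k, \sum_(k in E) lam k = 1
      & y = \sum_(k in E) lam k *: vtx k]].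

(* The polyhedral set covered by the simplices, taken open. *)
Definition meshdom m : set 'cV[R]_N :=
  interior (\bigcup_(E in [set` elts m]) hull E).

Definition meshsize m : R :=
  \big[Num.max/0]_(E in elts m) diam (hull E).

Definition nondegenerate m (E : {set 'I_(nv m)}) : Prop :=
  #|E| = N.+1 /\
  forall lam : 'I_(nv m) -> R,
    \sum_(k in E) lam k = 0 -> \sum_(k in E) lam k *: vtx k = 0 ->
    forall k, k \in E -> lam k = 0.

Definition P1 m (v : 'cV[R]_N -> R) : Prop :=
  {within closure (meshdom m), continuous v} /\
  forall E, E \in elts m -> exists (c : 'cV[R]_N) (b : R),
    forall y, hull E y -> v y = dotv c y + b.

(* faces of codimension one of E that lie in the boundary of O_h, each given
   by its opposite vertex *)
Definition bd_faces m (E : {set 'I_(nv m)}) : {set 'I_(nv m)} :=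
  [set k in E | `[< hull (E :\ k) `<=` bd (meshdom m) >]].

Record triangulation m : Prop := {
  vtx_inj : injective (@vtx m);
  vtx_used : forall k : 'I_(nv m), exists2 E, E \in elts m & k \in E;
  elts_nondegenerate : forall E, E \in elts m -> nondegenerate E;
  elts_conforming : forall E E', E \in elts m -> E' \in elts m ->
    hull E `&` hull E' = hull (E :&: E');
  psi_P1 : forall k, P1 m (@psi m k);
  psi_nodal : forall k l, psi k (@vtx m l) = (k == l)%:R
}.

Definition interp_vtx m (x : 'cV[R]_N) (l : 'I_(nv m)) : Prop :=
  0 < psi l (ph m x).

Definition Isp m (Phi : 'I_(nv m) -> R) (x : 'cV[R]_N) : R :=
  \sum_l psi l (ph m x) * Phi l.

End Mesh.

Arguments mesh R N : clear implicits.

Section Scheme.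
Context {R : realType} {N p M : nat} {A : metricType R}.
Context (P : problem R N p A) (Q : cubature R p M) (m : mesh R N) (Nt : nat).
Implicit Types (n : nat) (i : 'I_(nv m)) (a : A) (j : 'I_M).

Definition dt : R := horizon P / Nt%:R.

Definition tn n : R := n%:R * dt.

(* In the signed direction (j, b), b = false is the sign + and b = true the
   sign -. *)
Definition Gam n i a j (b : bool) (q : R) : 'cV[R]_N :=
  vtx i + q *: mu P (tn n) (vtx i) a
  + ((-1) ^+ b * Num.sqrt q) *: (sigma P (tn n) (vtx i) a *m eta Q j).

Definition exits n i a j b : set R :=
  [set q | 0 < q <= dt /\ ~ dom P (Gam n i a j b q)].

Definition chi n i a j b : bool := exits n i a j b != set0.

Definition exit_time n i a j b : R :=
  if chi n i a j b then inf (exits n i a j b) else dt.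

Definition root_time n i a j b : R := Num.sqrt (exit_time n i a j b).

Definition theta n i a j : R :=
  root_time n i a j false * root_time n i a j true.

Definition tau n i a : R := (\sum_j rho Q j / theta n i a j)^-1.

Definition omega n i a j b : R :=
  tau n i a * rho Q j /
  (root_time n i a j b * (root_time n i a j false + root_time n i a j true)).

Definition branch_val n i a j b (Phi : 'I_(nv m) -> R) : R :=
  let d := exit_time n i a j b in
  if ~~ chi n i a j b then Isp Phi (Gam n i a j b dt)
  else if tn n + d == horizon P then Psi P (Gam n i a j b d)
  else u_bd P (tn n + d) (Gam n i a j b d).

Definition Sop n i a (Phi : 'I_(nv m) -> R) : R :=
  \sum_(j < M) \sum_(b : bool) omega n i a j b *
    (branch_val n i a j b Phi
       / (1 + rate P (tn n) (vtx i) a * exit_time n i a j b)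
     + source P (tn n) (vtx i) a * exit_time n i a j b).

Definition Res n i a (U : R) (Phi : 'I_(nv m) -> R) : R :=
  (Sop n i a Phi - U) / tau n i a.

Definition Sres n i (U : R) (Phi : 'I_(nv m) -> R) : R :=
  inf (range (fun a => Res n i a U Phi)).

(* Off-grid end points at which some row evaluates the spatial interpolation,
   that is, end points of branches that do not leave the domain. *)
Definition off_grid : set 'cV[R]_N :=
  [set x | ~ range (@vtx _ _ m) x /\
    exists n i a j b, [/\ (n < Nt)%N, dom P (vtx i), ~~ chi n i a j b
                        & x = Gam n i a j b dt]].

(* The points used for interpolation by the full-step branch (j, b): its end
   point and the interpolation vertices used there. *)
Definition interp_point n i a j b : set 'cV[R]_N :=
  [set y | y = Gam n i a j b dt \/
    exists2 l, interp_vtx (Gam n i a j b dt) l & y = @vtx _ _ m l].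

Record mesh_ok (Cbd Cp Cpatch : R) : Prop := {
  mesh_triangulation : triangulation m;
  G1_bd : forall k : 'I_(nv m), bd (meshdom m) (vtx k) <-> bd (dom P) (vtx k);
  G1_in : forall k : 'I_(nv m), ~ bd (dom P) (vtx k) -> dom P (vtx k);
  G2 : forall E, E \in elts m -> (#|bd_faces E| <= 1)%N;
  G4_bd : (hausdorff_dist (bd (dom P)) (bd (meshdom m))
           <= (Cbd * meshsize m ^+ 2)%:E)%E;
  G4_ph_closure : forall x, closure (dom P) x ->
    closure (meshdom m) (ph m x);
  G4_ph_vtx : forall k : 'I_(nv m), ph m (vtx k) = vtx k;
  G4_ph_dist : forall x, closure (dom P) x ->
    enorm (ph m x - x) <= Cp * meshsize m ^+ 2;
  G4_patch : forall x l, off_grid x -> interp_vtx x l ->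
    [/\ enorm (@vtx _ _ m l - x) <= Cpatch * meshsize m,
        forall s : R, 0 <= s <= 1 ->
          closure (dom P) (x + s *: (vtx l - x))
      & forall s : R, 0 <= s < 1 -> dom P (x + s *: (vtx l - x))]
}.

End Scheme.

(* Main.v *)
Require Import Defs.
From HB Require Import structures.
From mathcomp Require Import all_boot all_order all_algebra.
From mathcomp Require Import all_classical all_reals all_analysis.
From mathcomp Require Import ring lra.
Set Implicit Arguments.
Unset Strict Implicit.
Unset Printing Implicit Defensive.
Import Order.TTheory GRing.Theory Num.Theory.
Import numFieldNormedType.Exports.
Local Open Scope classical_set_scope.
Local Open Scope ring_scope.

(** The node is so far from the boundary that nothing of the boundary is seen
    by its row. Since [Dt <= 1], a branch moves by at most
    [sqrt Dt * (|mu| + |sigma eta_j|) <= (BC - 1) * sqrt Dt], and an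
    interpolation vertex lies within [Cpatch * h] of the end point. A segment
    starting in an open set can only leave it through a boundary point
    ([segment_meets_bd]), so the Euclidean ball [row_ball] around the node lies
    in [inner (dom P) eps] and contains every point that matters. Hence no
    branch exits, all exit times are [Dt], and the weights become [rho_j / 2].

    For the residual, write [K = Creg * eps ^- 3], which bounds every derivative
    of parabolic order one to four. Opposite branches are paired, the end
    points being [x + u + v] and [x + u - v] with [u = Dt mu] of size [Dt] and
    [v = sqrt Dt sigma eta_j] of size [sqrt Dt]. The expansion is made in an
    order that never needs more than parabolic order four: first in time at the
    end points, to second order; then in the drift [u]; and last symmetrically
    in the noise [v], where the odd orders cancel and the fourth-order remainder
    is [O(Dt ^ 2 K)] ([pair_consistency]). The second-order noise terms,
    averaged with the weights [rho_j], give the trace in the generator because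
    the cubature has identity covariance ([cubature_trace]). So the average of
    the exact values is [phi + Dt * L phi + O(Dt ^ 2 K)], and division by
    [1 + rate * Dt] and then by [Dt] leaves an error [O(Dt * eps ^- 3)].

    Interpolation costs [O(h ^ 2 / eps)] before the division by [Dt]
    ([interp_consistency]). On a simplex the nodal basis functions are the
    barycentric coordinates, so the weights at [ph m y] are nonnegative, sum to
    one and have barycentre [ph m y] ([nodal_barycentric]). Expanding around
    [y], the gradient term only sees [ph m y - y = O(h ^ 2)], and the
    second-order remainders are [O(h ^ 2 / eps)].

    The hypotheses on the test function concern coordinate derivatives taken in
    one fixed order. The section on partial families supplies what relates them
    to the expansions: the symmetry of mixed derivatives, which extends the
    bounds to all orders of differentiation, and the chain rule along lines,
    which reduces every expansion to one variable. All constants depend on the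
    data only, so the estimate passes to the infimum over the controls. *)

(** * Taylor estimates on an interval *)

Section OneVariable.
Context {R : realType}.
Implicit Types (h : R -> R) (q K : R).

Lemma mvt01 h h1 : (forall q, 0 <= q <= 1 -> is_derive q 1 h (h1 q)) ->
  exists2 c, 0 <= c <= 1 & h 1 - h 0 = h1 c.
Proof.
move=> dh; have [| |c] := @MVT_segment R h h1 0 1 ler01.
- by move=> x; rewrite in_itv/= => /andP[x0 x1]; apply: dh; rewrite !ltW.
- apply: continuous_in_subspaceT => x; rewrite inE/= in_itv/= => x01.
  have dx := dh x x01.
  by apply/differentiable_continuous/derivable1_diffP; exact: ex_derive.
- by rewrite in_itv/= => c01 ->; exists c => //; rewrite subr0 mulr1.
Qed.

Lemma is_derive_scale_arg h (c q d : R) :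
  is_derive (c * q) 1 h d -> is_derive q 1 (fun s => h (c * s)) (c * d).
Proof.
move=> dh; rewrite mulrC; apply: (@is_derive1_comp R h (fun s => c * s)) => //.
have := is_deriveZ c (is_derive_id q (1 : R)).
by rewrite -[c *: 1]/(c * 1) mulr1.
Qed.

Lemma mvt_segment h h1 (a b : R) :
  (forall q, 0 <= q <= 1 -> is_derive (a + q * (b - a)) 1 h (h1 (a + q * (b - a)))) ->
  exists2 q, 0 <= q <= 1 & h b - h a = h1 (a + q * (b - a)) * (b - a).
Proof.
move=> dh.
have [q q01|c c01] := @mvt01 (fun s => h (a + s * (b - a)))
  (fun s => h1 (a + s * (b - a)) * (b - a)).
  apply: (@is_derive1_comp R h (fun s => a + s * (b - a))); first exact: dh.
  have := is_deriveD (is_derive_cst a q 1) (is_deriveZ (b - a) (is_derive_id q (1 : R))).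
  rewrite add0r -[(b - a) *: 1]/((b - a) * 1) mulr1.
  have -> // : (fun s => a + s * (b - a)) = cst a + ((b - a) \*: @idfun R).
  by apply/funext => s; rewrite mulrC.
by rewrite mul1r mul0r addr0 subrKC => ->; exists c.
Qed.

Lemma taylor2 h h1 h2 K :
  (forall q, 0 <= q <= 1 -> is_derive q 1 h (h1 q)) ->
  (forall q, 0 <= q <= 1 -> is_derive q 1 h1 (h2 q)) ->
  (forall q, 0 <= q <= 1 -> `|h2 q| <= K) ->
  `|h 1 - h 0 - h1 0| <= K.
Proof.
move=> dh dh1 K2; have [c /andP[c0 c1] ->] := mvt01 dh.
have sub q : 0 <= q <= 1 -> 0 <= 0 + q * (c - 0) <= 1.
  by move=> /andP[q0 q1]; rewrite add0r subr0 mulr_ge0 //= mulr_ile1.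
have [q /sub/K2 q01 ->] := @mvt_segment h1 h2 0 c (fun q q01 => dh1 _ (sub q q01)).
rewrite normrM [X in _ * X]ger0_norm ?subr0 // -[leRHS]mulr1.
by apply: ler_pM => //; rewrite -[q * c](congr1 _ (subr0 c)).
Qed.

(** The first-order terms of the two opposite increments cancel. *)
Lemma symmetric_difference2 h h1 h2 K q :
  (forall q, -1 <= q <= 1 -> is_derive q 1 h (h1 q)) ->
  (forall q, -1 <= q <= 1 -> is_derive q 1 h1 (h2 q)) ->
  (forall q, -1 <= q <= 1 -> `|h2 q| <= K) ->
  0 <= q <= 1 -> `|h q + h (- q) - 2 * h 0| <= 2 * K.
Proof.
move=> dh dh1 K2 /andP[q0 q1].
have up s : 0 <= s <= 1 -> -1 <= q * s <= 1 by move=> /andP[s0 s1]; nra.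
have dn s : 0 <= s <= 1 -> -1 <= - q * s <= 1 by move=> /andP[s0 s1]; nra.
have T c : `|c| <= 1 -> (forall s, 0 <= s <= 1 -> -1 <= c * s <= 1) ->
    `|h c - h 0 - c * h1 0| <= K.
  move=> c1 hc.
  have := @taylor2 (fun s => h (c * s)) (fun s => c * h1 (c * s))
    (fun s => c * (c * h2 (c * s))) K.
  rewrite mulr1 mulr0; apply.
  - by move=> s /hc/dh; exact: is_derive_scale_arg.
  - move=> s /hc/dh1 ds.
    exact: (is_deriveZ c (is_derive_scale_arg ds)).
  - move=> s /hc/K2 h2K; rewrite !normrM mulrA -[leRHS]mul1r.
    by apply: ler_pM => //; rewrite mulr_ile1.
have := T _ _ dn; have := T _ _ up.
rewrite normrN ger0_norm // => /(_ q1) + /(_ q1).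
move=> /ler_normlP[? ?] /ler_normlP[? ?]; apply/ler_normlP; split; lra.
Qed.

(** Subtracting [q ^ 2 h''(0)] leaves an even function whose second derivative is
    the symmetric difference of [h''], already known to be of second order. *)
Lemma symmetric_difference4 h h1 h2 h3 h4 K :
  (forall q, -1 <= q <= 1 -> is_derive q 1 h (h1 q)) ->
  (forall q, -1 <= q <= 1 -> is_derive q 1 h1 (h2 q)) ->
  (forall q, -1 <= q <= 1 -> is_derive q 1 h2 (h3 q)) ->
  (forall q, -1 <= q <= 1 -> is_derive q 1 h3 (h4 q)) ->
  (forall q, -1 <= q <= 1 -> `|h4 q| <= K) ->
  `|h 1 + h (- 1) - 2 * h 0 - h2 0| <= 2 * K.
Proof.
move=> dh dh1 dh2 dh3 K4.
have dN (k k1 : R -> R) : (forall q, -1 <= q <= 1 -> is_derive q 1 k (k1 q)) ->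
    forall q, 0 <= q <= 1 -> is_derive q 1 (fun s => k (- s)) (- k1 (- q)).
  move=> dk q q01; have := @is_derive_scale_arg k (-1) q (k1 (- q)).
  rewrite !mulN1r; move/(_ (dk _ _)).
  have -> : (fun s => k (-1 * s)) = (fun s => k (- s)).
    by apply/funext => s; rewrite mulN1r.
  by apply; lra.
pose k q := h q + h (- q) - q * q * h2 0.
pose k1 q := h1 q - h1 (- q) - 2 * q * h2 0.
pose k2 q := h2 q + h2 (- q) - 2 * h2 0.
have -> : h 1 + h (- 1) - 2 * h 0 - h2 0 = k 1 - k 0 - k1 0.
  by rewrite /k /k1 oppr0; ring.
apply: (@taylor2 k k1 k2).
- move=> q q01.
  have dq : is_derive q 1 h (h1 q) by apply: dh; lra.
  have := is_deriveB (is_deriveD dq (dN _ _ dh q q01))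
    (is_deriveZ (h2 0) (is_deriveM (is_derive_id q 1) (is_derive_id q 1))).
  move=> D; have -> : k = h + (fun s => h (- s)) - (h2 0 \*: (@idfun R * @idfun R)).
    by apply/funext => s; rewrite /k mulrC.
  apply: (is_derive_eq D); rewrite /k1 -[_ *: (_ + _)]/(h2 0 * (q * 1 + q * 1)).
  ring.
- move=> q q01.
  have dq : is_derive q 1 h1 (h2 q) by apply: dh1; lra.
  have D := is_deriveB (is_deriveB dq (dN _ _ dh1 q q01))
    (is_deriveZ (2 * h2 0) (is_derive_id q 1)).
  have -> : k1 = h1 - (fun s => h1 (- s)) - ((2 * h2 0) \*: (@idfun R)).
    by apply/funext => s; rewrite /k1 mulrAC.
  apply: (is_derive_eq D); rewrite /k2 -[_ *: 1]/(2 * h2 0 * 1).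
  ring.
- move=> q q01; apply: symmetric_difference2 dh2 dh3 K4 _ => //.
Qed.
End OneVariable.

(** * Derivatives along lines *)

Section Lines.
Context {R : realType} {V : normedModType R}.
Implicit Types (f : V -> R) (z v : V).

Lemma is_derive_line f z v (q d : R) :
  is_derive (z + q *: v) v f d <-> is_derive q 1 (fun s => f (z + s *: v)) d.
Proof.
have E : (fun h : R => h^-1 *: ((f \o shift (z + q *: v)) (h *: v) - f (z + q *: v)))
  = (fun h : R => h^-1 *: (((fun s : R => f (z + s *: v)) \o shift q) (h *: (1 : R)) - f (z + q *: v))).
  apply/funext => h /=; congr (_ *: (f _ - _)).
  by rewrite /shift /= scalerDl -[h *: 1]/(h * 1) mulr1 addrCA.
split=> -[dx dv].
  by split; [rewrite /derivable -E | rewrite /derive -E].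
by split; [rewrite /derivable E | rewrite /derive E].
Qed.

Lemma is_derive_shift_arg f c x v (d : R) :
  is_derive (x + c) v f d -> is_derive x v (fun y => f (y + c)) d.
Proof.
have E : (fun h : R => h^-1 *: ((f \o shift (x + c)) (h *: v) - f (x + c)))
  = (fun h : R => h^-1 *: (((fun y => f (y + c)) \o shift x) (h *: v) - f (x + c))).
  by apply/funext => h /=; rewrite /shift /= addrA.
by case=> dx dv; split; [rewrite /derivable -E | rewrite /derive -E].
Qed.

Lemma line_mvt f (G : V -> R) z v (t : R) :
  (forall s, 0 <= s <= 1 -> is_derive (z + (s * t) *: v) v f (G (z + (s * t) *: v))) ->
  exists2 s, 0 <= s <= 1 & f (z + t *: v) - f z = G (z + (s * t) *: v) * t.
Proof.
move=> df; have [q q01|s s01] := @mvt_segment R (fun s => f (z + s *: v))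
    (fun s => G (z + s *: v)) 0 t.
  by apply/is_derive_line; rewrite add0r subr0; exact: df.
by rewrite scale0r addr0 add0r subr0 => ?; exists s.
Qed.

Lemma line_increment_le f (G : V -> R) z v (t c e : R) :
  (forall s, 0 <= s <= 1 -> is_derive (z + (s * t) *: v) v f (G (z + (s * t) *: v))) ->
  (forall s, 0 <= s <= 1 -> `|G (z + (s * t) *: v) - c| <= e) ->
  `|f (z + t *: v) - f z - t * c| <= `|t| * e.
Proof.
move=> /line_mvt[s s01 ->] /(_ s s01) Ge.
by rewrite [_ * t]mulrC -mulrBr normrM ler_wpM2l.
Qed.
End Lines.

(** * Functions with continuous partial derivatives of all orders *)

Section PartialFamily.
Context {R : realType} {N : nat}.
Local Notation cV := 'cV[R]_N.
Local Notation e_ := (@unit_vec R N).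
Implicit Types (U : set cV) (F : seq 'I_N -> cV -> R) (w : seq 'I_N).

(** [F w] stands for the iterated partial derivative of [F [::]] along the word
    [w], the head of [w] being differentiated last. Only coordinate directions
    are given; other directions and the symmetry of mixed derivatives have to be
    derived from continuity. *)
Definition partial_family U F : Prop := forall w x, U x ->
  (forall k, is_derive x (e_ k) (F w) (F (k :: w) x)) /\
  {for x, continuous (F w)}.

Lemma cV_norm_le (x : cV) (e : R) : 0 <= e ->
  (forall k, `|x k ord0| <= e) -> `|x| <= e.
Proof.
move=> e0 xe; rewrite [`|x|]mx_normrE; apply/bigmax_leP; split=> // -[k l] _ /=.
by rewrite (ord1 l).
Qed.

Lemma norm_unit_vec k : `|e_ k| <= 1.
Proof.
apply: cV_norm_le => // l; rewrite mxE; by case: (_ && _); rewrite ?normr1 ?normr0.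
Qed.

(** Near a point of an open set finitely many continuous functions stay close
    to their values there. *)
Lemma near_family U F x (ws : seq (seq 'I_N)) (e : R) : open U ->
  partial_family U F -> U x -> 0 < e ->
  exists2 r : R, 0 < r & forall y, `|y - x| < r ->
    U y /\ forall w, w \in ws -> `|F w y - F w x| <= e.
Proof.
move=> oU FU Ux e0.
have : \forall y \near x, U y /\ forall w, w \in ws -> `|F w y - F w x| <= e.
  apply: filterI; first exact: open_nbhs_nbhs.
  elim: ws => [|w ws IH]; first by apply: filterE => y w; rewrite in_nil.
  have [_ /cvgr_dist_le/(_ _ e0) Fw] := FU w x Ux.
  near=> y => w'; rewrite in_cons => /orP[/eqP ->|w'ws].
    by rewrite distrC; near: y.
  by move: w' w'ws; near: y.
move=> /nbhs_ballP[r /= r0 rb]; exists r => // y yx.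
by apply: rb; rewrite -ball_normE /= distrC.
Unshelve. all: by end_near. Qed.

(** Schwarz' theorem: the second difference of [F w] on a small parallelogram is
    close to [t ^ 2] times either mixed derivative, according to the side along
    which the mean value inequality is applied first. *)
Lemma mixed_partials U F x k l w : open U -> partial_family U F -> U x ->
  F (k :: l :: w) x = F (l :: k :: w) x.
Proof.
move=> oU FU Ux; apply/eqP; rewrite -subr_eq0 -normr_le0; apply/ler_addgt0Pl => e e0.
rewrite addr0.
have e20 : 0 < e / 2 by lra.
have [r r0 near] := near_family [:: k :: l :: w; l :: k :: w] oU FU Ux e20.
pose t := r / 3; have t0 : 0 < t by rewrite /t; lra.
(* the increment along [a] of the increment along [b] *)
have D a b : (b :: a :: w) \in [:: k :: l :: w; l :: k :: w] ->
    `|F w (x + t *: e_ b + t *: e_ a) - F w (x + t *: e_ a) - F w (x + t *: e_ b)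
      + F w x - t * (t * F (b :: a :: w) x)| <= t * (t * (e / 2)).
  move=> abw.
  have inb s s' : 0 <= s <= 1 -> 0 <= s' <= 1 ->
      `|x + (s * t) *: e_ a + (s' * t) *: e_ b - x| < r.
    move=> /andP[s0 s1] /andP[s'0 s'1]; rewrite -[x + _ + _]addrA addrAC subrr add0r.
    have lt1 (q : R) c : 0 <= q -> q <= 1 -> `|(q * t) *: e_ c| <= t.
      move=> q0 q1; rewrite normrZ ger0_norm; last by rewrite mulr_ge0// ltW.
      rewrite -[leRHS]mulr1; apply: ler_pM => //; last exact: norm_unit_vec.
        by rewrite mulr_ge0 // ltW.
      by rewrite ler_piMl // ltW.
    apply: (le_lt_trans (ler_normD _ _)); apply: (@le_lt_trans _ _ (t + t)).
      by apply: lerD; exact: lt1.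
    by rewrite /t; lra.
  have := @line_increment_le R cV (fun y => F w (y + t *: e_ b) - F w y)
    (fun y => F (a :: w) (y + t *: e_ b) - F (a :: w) y) x (e_ a) t
    (t * F (b :: a :: w) x) (t * (e / 2)).
  rewrite [`|t|]gtr0_norm //.
  have -> : F w (x + t *: e_ b + t *: e_ a) - F w (x + t *: e_ a) -
      F w (x + t *: e_ b) + F w x - t * (t * F (b :: a :: w) x) =
    F w (x + t *: e_ a + t *: e_ b) - F w (x + t *: e_ a) -
      (F w (x + t *: e_ b) - F w x) - t * (t * F (b :: a :: w) x).
    by rewrite -(addrAC x (t *: e_ a)); ring.
  apply=> s s01.
    have i0 : 0 <= (0 : R) <= 1 by rewrite lexx ler01.
    have i1 : 0 <= (1 : R) <= 1 by rewrite lexx ler01.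
    have U0 := (near _ (inb s 0 s01 i0)).1; rewrite mul0r scale0r addr0 in U0.
    have U1 := (near _ (inb s 1 s01 i1)).1; rewrite mul1r in U1.
    apply: is_deriveB; last exact: (FU w _ U0).1.
    by apply: is_derive_shift_arg; exact: (FU w _ U1).1.
  have := @line_increment_le R cV (F (a :: w)) (F (b :: a :: w))
    (x + (s * t) *: e_ a) (e_ b) t (F (b :: a :: w) x) (e / 2).
  rewrite [`|t|]gtr0_norm //; apply=> s' s'01.
    by apply: (FU _ _ _).1; exact: (near _ (inb s s' s01 s'01)).1.
  apply: (near _ _).2 => //; exact: inb.
have := D k l; have := D l k; rewrite !inE !eqxx orbT => /(_ isT) + /(_ isT).
rewrite [x + _ + _]addrAC => /ler_normlP[A1 A2] /ler_normlP[B1 B2].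
have tt : 0 < t * t by rewrite mulr_gt0.
rewrite -(ler_pM2l tt) -[t * t in X in X <= _]gtr0_norm // -normrM.
apply/ler_normlP; split; lra.
Qed.

(** Differentiation is local, so an identity between two members on an open set
    may be differentiated there. *)
Lemma family_cons_eq U F k w1 w2 : open U -> partial_family U F ->
  (forall x, U x -> F w1 x = F w2 x) ->
  forall x, U x -> F (k :: w1) x = F (k :: w2) x.
Proof.
move=> oU FU E x Ux.
have [/(_ k)[_ <-] _] := FU w1 x Ux; have [/(_ k)[_ <-] _] := FU w2 x Ux.
apply: near_eq_derive; near=> y; apply: E; near: y; exact: open_nbhs_nbhs.
Unshelve. all: by end_near. Qed.

(** Adjacent letters are exchanged one pair at a time. *)
Lemma family_perm U F w1 w2 : open U -> partial_family U F -> perm_eq w1 w2 ->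
  forall x, U x -> F w1 x = F w2 x.
Proof.
move=> oU FU; elim: w1 w2 => [|k w1 IH] w2.
  by rewrite perm_sym => /perm_nilP ->.
move=> p12; have kw2 : k \in w2 by rewrite -(perm_mem p12) mem_head.
case/splitPr: kw2 p12 => s1 s2; rewrite perm_sym perm_catC cat_cons perm_cons.
rewrite perm_catC perm_sym => /IH E x Ux.
rewrite (family_cons_eq k oU FU E Ux).
elim: s1 x Ux {IH E} => [|l s1 IH] x Ux //.
by rewrite !cat_cons (mixed_partials _ _ _ oU FU Ux) (family_cons_eq l oU FU IH Ux).
Qed.

(** The increment is split into one step per coordinate, each controlled by the
    mean value inequality. *)
Lemma family_increment U F w x u (d e : R) : partial_family U F -> `|u| <= d ->
  (forall y, `|y - x| <= d ->
     U y /\ forall k, `|F (k :: w) y - F (k :: w) x| <= e) ->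
  `|F w (x + u) - F w x - \sum_k u k ord0 * F (k :: w) x|
    <= (\sum_k `|u k ord0|) * e.
Proof.
move=> FU ud near.
have d0 : 0 <= d := le_trans (normr_ge0 u) ud.
pose tr (m : nat) : cV := \col_k (if (k < m)%N then u k ord0 else 0).
have ue k : `|u k ord0| <= d.
  have := le_bigmax 0 (fun i : 'I_N * 'I_1 => `|u i.1 i.2|) (k, ord0).
  by rewrite -mx_normrE /= => /le_trans; apply.
suff S m : (m <= N)%N ->
    `|F w (x + tr m) - F w x - \sum_(k < N | (k < m)%N) u k ord0 * F (k :: w) x|
    <= (\sum_(k < N | (k < m)%N) `|u k ord0|) * e.
  have trN : tr N = u by apply/colP => k; rewrite !mxE ltn_ord.
  by have := S N (leqnn N); rewrite trN !(eq_bigl xpredT _ (fun k => ltn_ord k)).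
elim: m => [_|m IH mN].
  have -> : tr 0 = 0 by apply/colP => k; rewrite !mxE.
  by rewrite !big_pred0 // addr0 subrr subr0 normr0 mul0r.
pose k0 := Ordinal mN.
have trS : tr m.+1 = tr m + (u k0 ord0) *: e_ k0.
  apply/colP => k; rewrite !mxE eqxx andbT ltnS leq_eqVlt -[k == k0]/(k == m :> nat).
  case: eqP => [km|_] /=.
    by rewrite (_ : k = k0) ?ltnn ?add0r ?mulr1 //; apply: val_inj.
  by rewrite mulr0 addr0.
have split_sum (g : 'I_N -> R) :
    \sum_(k < N | (k < m.+1)%N) g k = \sum_(k < N | (k < m)%N) g k + g k0.
  rewrite (bigD1 k0) ?ltnSn //= addrC; congr (_ + _); apply: eq_bigl => k.
  by rewrite ltnS andbC -[k == k0]/(k == m :> nat) ltn_neqAle.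
have := @line_increment_le R cV (F w) (F (k0 :: w)) (x + tr m) (e_ k0) (u k0 ord0)
  (F (k0 :: w) x) e.
have inb s : 0 <= s <= 1 -> `|x + tr m + (s * u k0 ord0) *: e_ k0 - x| <= d.
  move=> /andP[s0 s1]; rewrite -[x + _ + _]addrA addrAC subrr add0r.
  apply: cV_norm_le => // k; rewrite !mxE eqxx andbT.
  have [->|kk0] := eqVneq k k0.
    rewrite ltnn add0r mulr1 normrM (ger0_norm s0); apply: le_trans (ue k0).
    by rewrite ler_piMl.
  by rewrite mulr0 addr0; case: ifP; rewrite ?normr0.
move=> /(_ (fun s s01 => (FU w _ (near _ (inb s s01)).1).1 k0)).
move=> /(_ (fun s s01 => (near _ (inb s s01)).2 k0)).
rewrite -[x + _ + _]addrA -trS !split_sum mulrDl; have := IH (ltnW mN).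
move: (\sum_(_ | _) (_ * _)) ((\sum_(_ | _) `|_|) * e) => a b.
move=> /ler_normlP[? ?] /ler_normlP[? ?]; apply/ler_normlP; split; lra.
Qed.

(** The chain rule along a line; the existence of continuous partial derivatives
    replaces differentiability. *)
Lemma is_derive_family U F w x v : open U -> partial_family U F -> U x ->
  is_derive x v (F w) (\sum_k v k ord0 * F (k :: w) x).
Proof.
move=> oU FU Ux; set L := \sum_k _.
suff C : (fun h : R => h^-1 *: ((F w \o shift x) (h *: v) - F w x)) @ 0^' --> L.
  by split; [apply/cvg_ex; exists L | apply: cvg_lim].
apply/cvgrPdist_le => e e0.
pose l := 1 + \sum_k `|v k ord0|.
have l0 : 0 < l by rewrite ltr_pwDl // sumr_ge0.
have [r r0 near] := near_family [seq k :: w | k <- enum 'I_N] oU FU Ux (divr_gt0 e0 l0).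
near=> h.
have h0 : h != 0 by near: h; exact: nbhs_dnbhs_neq.
have hv : `|h *: v| <= r / 2.
  rewrite normrZ; apply: (@le_trans _ _ (`|h| * (1 + `|v|))).
    by rewrite ler_wpM2l // lerDr.
  have v0 : 0 < 1 + `|v| by rewrite ltr_pwDl.
  rewrite -ler_pdivlMr //; near: h; apply: dnbhs0_le.
  by rewrite divr_gt0 // divr_gt0.
have near2 y : `|y - x| <= r / 2 ->
    U y /\ forall k, `|F (k :: w) y - F (k :: w) x| <= e / l.
  move=> yx; have [|Uy Fy] := near y; first by apply: (le_lt_trans yx); lra.
  by split=> // k; apply: Fy; apply: map_f; rewrite mem_enum.
have := @family_increment U F w _ _ _ _ FU hv near2.
have -> : \sum_k (h *: v) k ord0 * F (k :: w) x = h * L.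
  by rewrite mulr_sumr; apply: eq_bigr => k _; rewrite mxE mulrA.
have -> : \sum_k `|(h *: v) k ord0| = `|h| * \sum_k `|v k ord0|.
  by rewrite mulr_sumr; apply: eq_bigr => k _; rewrite mxE normrM.
move=> I.
rewrite distrC /= [_ + x]addrC -[L](mulKf h0) -[_ *: _]/(_ * _) -mulrBr normrM normfV.
rewrite ler_pdivrMl ?normr_gt0 //; apply: (le_trans I).
rewrite -mulrA ler_wpM2l // mulrCA -[leRHS]mulr1 (ler_wpM2l (ltW e0)) //.
by rewrite ler_pdivrMr // mul1r /l lerDr.
Unshelve. all: by end_near. Qed.

End PartialFamily.

(** * Taylor expansions in several variables *)

Section DirectionalIterates.
Context {R : realType} {N : nat}.
Local Notation cV := 'cV[R]_N.
Implicit Types (U : set cV) (F : seq 'I_N -> cV -> R) (w : seq 'I_N).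

Definition l1norm (v : cV) : R := \sum_k `|v k ord0|.

(** [n]-th derivative in the direction [v] of the member [w] of a family. *)
Fixpoint dir_iter F (v : cV) (n : nat) w (x : cV) : R :=
  if n is n'.+1 then \sum_k v k ord0 * dir_iter F v n' (k :: w) x else F w x.

Lemma l1norm_ge0 v : 0 <= l1norm v. Proof. exact: sumr_ge0. Qed.

Lemma l1normZ c v : l1norm (c *: v) = `|c| * l1norm v.
Proof. by rewrite mulr_sumr; apply: eq_bigr => k _; rewrite mxE normrM. Qed.

Lemma dir_iterZ F c v n w x :
  dir_iter F (c *: v) n w x = c ^+ n * dir_iter F v n w x.
Proof.
elim: n w => [|n IH] w /=; first by rewrite mul1r.
rewrite mulr_sumr; apply: eq_bigr => k _.
by rewrite IH mxE exprS; ring.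
Qed.

Lemma sum_l1_le (v : cV) (g : 'I_N -> R) (K : R) :
  (forall k, `|g k| <= K) -> `|\sum_k v k ord0 * g k| <= l1norm v * K.
Proof.
move=> gK; apply: (le_trans (ler_norm_sum _ _ _)); rewrite mulr_suml.
by apply: ler_sum => k _; rewrite normrM ler_wpM2l.
Qed.

Lemma dir_iter_le F v n w x (K : R) :
  (forall w', size w' = (n + size w)%N -> `|F w' x| <= K) ->
  `|dir_iter F v n w x| <= l1norm v ^+ n * K.
Proof.
elim: n w => [|n IH] w FK /=; first by rewrite expr0 mul1r; exact: FK.
rewrite exprS -mulrA; apply: sum_l1_le => k; apply: IH => w' sw'.
by apply: FK; rewrite sw' /= addnS.
Qed.

Lemma is_derive_dir_iter U F v n w x : open U -> partial_family U F -> U x ->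
  is_derive x v (dir_iter F v n w) (dir_iter F v n.+1 w x).
Proof.
move=> oU FU Ux; elim: n w => [|n IH] w; first exact: (@is_derive_family R N U F w x v oU FU Ux).
have := is_derive_sum (fun k : 'I_N => is_deriveZ (v k ord0) (IH (k :: w))).
congr is_derive; apply/funext => y; rewrite fct_sumE.
by apply: eq_bigr.
Qed.

Section Expansions.
Variables (U : set cV) (F : seq 'I_N -> cV -> R) (w : seq 'I_N) (x v : cV) (K : R).
Hypotheses (oU : open U) (FU : partial_family U F).

Let path n q := dir_iter F v n w (x + q *: v).

Let path_derive n q : U (x + q *: v) -> is_derive q 1 (path n) (path n.+1 q).
Proof. by move=> Uq; have /is_derive_line := is_derive_dir_iter v n w oU FU Uq. Qed.

Let path0 n : path n 0 = dir_iter F v n w x.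
Proof. by rewrite /path scale0r addr0. Qed.

Let path1 n : path n 1 = dir_iter F v n w (x + v).
Proof. by rewrite /path scale1r. Qed.

Let pathN1 n : path n (-1) = dir_iter F v n w (x - v).
Proof. by rewrite /path scaleN1r. Qed.

Let path_le n q : (forall w' y, size w' = (n + size w)%N -> U y -> `|F w' y| <= K) ->
  U (x + q *: v) -> `|path n q| <= l1norm v ^+ n * K.
Proof. by move=> FK Uq; apply: dir_iter_le => w' sw'; exact: FK. Qed.

Lemma family_lipschitz :
  (forall q, 0 <= q <= 1 -> U (x + q *: v)) ->
  (forall w' y, size w' = (1 + size w)%N -> U y -> `|F w' y| <= K) ->
  `|F w (x + v) - F w x| <= l1norm v * K.
Proof.
move=> Uq FK; have [c c01] := mvt01 (fun q q01 => path_derive 0 (Uq q q01)).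
by rewrite path0 path1 /= => ->; have := path_le FK (Uq c c01); rewrite expr1.
Qed.

Lemma family_taylor2 :
  (forall q, 0 <= q <= 1 -> U (x + q *: v)) ->
  (forall w' y, size w' = (2 + size w)%N -> U y -> `|F w' y| <= K) ->
  `|F w (x + v) - F w x - \sum_k v k ord0 * F (k :: w) x| <= l1norm v ^+ 2 * K.
Proof.
move=> Uq FK; have := @taylor2 R (path 0) (path 1) (path 2) (l1norm v ^+ 2 * K).
rewrite !path0 path1 /=; apply=> q q01; [exact/path_derive/Uq.. |].
by apply: path_le => //; exact: Uq.
Qed.

Lemma family_symmetric2 :
  (forall q, -1 <= q <= 1 -> U (x + q *: v)) ->
  (forall w' y, size w' = (2 + size w)%N -> U y -> `|F w' y| <= K) ->
  `|F w (x + v) + F w (x - v) - 2 * F w x| <= 2 * (l1norm v ^+ 2 * K).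
Proof.
move=> Uq FK; have := @symmetric_difference2 R (path 0) (path 1) (path 2)
  (l1norm v ^+ 2 * K) 1.
rewrite !path0 path1 pathN1 /=; apply=> [q q01|q q01|q q01|].
- exact/path_derive/Uq.
- exact/path_derive/Uq.
- by apply: path_le => //; exact: Uq.
- by rewrite ler01 lexx.
Qed.

Lemma family_symmetric4 :
  (forall q, -1 <= q <= 1 -> U (x + q *: v)) ->
  (forall w' y, size w' = (4 + size w)%N -> U y -> `|F w' y| <= K) ->
  `|F w (x + v) + F w (x - v) - 2 * F w x - dir_iter F v 2 w x|
    <= 2 * (l1norm v ^+ 4 * K).
Proof.
move=> Uq FK; have := @symmetric_difference4 R (path 0) (path 1) (path 2) (path 3)
  (path 4) (l1norm v ^+ 4 * K).
rewrite !path0 path1 pathN1 /=; apply=> q q01.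
1-4: exact/path_derive/Uq.
by apply: path_le => //; exact: Uq.
Qed.

End Expansions.

Section Branches.
Variables (U : set cV) (F : seq 'I_N -> cV -> R) (x u v : cV) (K : R).
Hypotheses (oU : open U) (FU : partial_family U F).
Hypothesis branch : forall q q', -1 <= q <= 1 -> -1 <= q' <= 1 ->
  U (x + q *: u + q' *: v).

(** The opposite noise displacements [v] and [- v] cancel to first order, so the
    error is of the size of [u] and of the square of [v]. *)
Lemma branch_pair_lipschitz :
  (forall w y, (1 <= size w <= 2)%N -> U y -> `|F w y| <= K) ->
  `|F [::] (x + u + v) + F [::] (x + u - v) - 2 * F [::] x|
    <= 2 * ((l1norm u + l1norm v ^+ 2) * K).
Proof.
move=> FK.
have i1 : -1 <= (1 : R) <= 1 by lra.
have i0 : -1 <= (0 : R) <= 1 by lra.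
have A : `|F [::] (x + u + v) + F [::] (x + u - v) - 2 * F [::] (x + u)|
    <= 2 * (l1norm v ^+ 2 * K).
  apply: (family_symmetric2 oU FU) => [q q1|w y ws].
    by have := branch i1 q1; rewrite scale1r.
  by apply: FK; rewrite ws.
have B : `|F [::] (x + u) - F [::] x| <= l1norm u * K.
  apply: (family_lipschitz oU FU) => [q /andP[q0 q1]|w y ws].
    have q1' : -1 <= q <= 1 by lra.
    by have := branch q1' i0; rewrite scale0r addr0.
  by apply: FK; rewrite ws.
move: A B => /ler_normlP[? ?] /ler_normlP[? ?]; apply/ler_normlP; split; lra.
Qed.

(** Expanding in [u] first, at the two displaced points, leaves only symmetric
    differences in [v]: a fourth-order one of [F [::]] and second-order ones of the
    gradient, the latter already multiplied by the small [u]. *)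
Lemma branch_pair_expansion :
  (forall w y, (1 <= size w <= 4)%N -> U y -> `|F w y| <= K) ->
  `|F [::] (x + u + v) + F [::] (x + u - v)
     - 2 * (F [::] x + \sum_k u k ord0 * F [:: k] x) - dir_iter F v 2 [::] x|
    <= 2 * ((l1norm u ^+ 2 + l1norm u * l1norm v ^+ 2 + l1norm v ^+ 4) * K).
Proof.
move=> FK.
have i1 : -1 <= (1 : R) <= 1 by lra.
have iN1 : -1 <= (-1 : R) <= 1 by lra.
have i0 : -1 <= (0 : R) <= 1 by lra.
have Uv q : -1 <= q <= 1 -> U (x + q *: v).
  by move=> q1; have := branch i0 q1; rewrite scale0r addr0.
have A : `|F [::] (x + v) + F [::] (x - v) - 2 * F [::] x - dir_iter F v 2 [::] x|
    <= 2 * (l1norm v ^+ 4 * K).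
  by apply: (family_symmetric4 oU FU) => // w y ws; apply: FK; rewrite ws.
have B s : -1 <= s <= 1 -> `|F [::] (x + u + s *: v) - F [::] (x + s *: v)
     - \sum_k u k ord0 * F [:: k] (x + s *: v)| <= l1norm u ^+ 2 * K.
  move=> s1; rewrite -(addrAC x (s *: v)); apply: (family_taylor2 oU FU) => [q /andP[q0 q1]|w y ws].
    have q1' : -1 <= q <= 1 by lra.
    by have := branch q1' s1; rewrite addrAC.
  by apply: FK; rewrite ws.
have C : `|\sum_k u k ord0 * (F [:: k] (x + v) + F [:: k] (x - v) - 2 * F [:: k] x)|
    <= l1norm u * (2 * (l1norm v ^+ 2 * K)).
  apply: sum_l1_le => k; apply: (family_symmetric2 oU FU) => // w y ws.
  by apply: FK; rewrite ws.
have E : \sum_k u k ord0 * (F [:: k] (x + v) + F [:: k] (x - v) - 2 * F [:: k] x)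
  = \sum_k u k ord0 * F [:: k] (x + v) + \sum_k u k ord0 * F [:: k] (x - v)
    - 2 * \sum_k u k ord0 * F [:: k] x.
  by rewrite mulr_sumr -big_split -sumrB; apply: eq_bigr => k _ /=; ring.
have := B _ iN1; have := B _ i1; rewrite {B} scale1r scaleN1r.
move: A C; rewrite {}E.
move=> /ler_normlP[? ?] /ler_normlP[? ?] /ler_normlP[? ?] /ler_normlP[? ?].
apply/ler_normlP; split; lra.
Qed.

End Branches.
End DirectionalIterates.

(** * Euclidean geometry: distance to the boundary *)

Section EuclideanNorm.
Context {R : realType} {N : nat}.
Local Notation cV := 'cV[R]_N.
Implicit Types (x y z : cV) (S : set cV).

Lemma enormE x : enorm x = Num.sqrt (\sum_k x k ord0 ^+ 2).
Proof. by congr Num.sqrt; apply: eq_bigr => k _; rewrite big_ord1. Qed.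

Lemma enorm_ge0 x : 0 <= enorm x. Proof. exact: sqrtr_ge0. Qed.

Lemma sqr_enorm x : enorm x ^+ 2 = \sum_k x k ord0 ^+ 2.
Proof. by rewrite enormE sqr_sqrtr // sumr_ge0 // => k _; exact: sqr_ge0. Qed.

Lemma enormZ c x : enorm (c *: x) = `|c| * enorm x.
Proof.
rewrite !enormE -sqrtr_sqr -sqrtrM ?sqr_ge0 // mulr_sumr; congr Num.sqrt.
by apply: eq_bigr => k _; rewrite mxE exprMn.
Qed.

Lemma enormN x : enorm (- x) = enorm x.
Proof. by rewrite -scaleN1r enormZ normrN1 mul1r. Qed.

Lemma enormB x y : enorm (x - y) = enorm (y - x).
Proof. by rewrite -enormN opprB. Qed.

(** Cauchy-Schwarz, from the nonnegativity of the square norm of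
    [enorm y *: x - enorm x *: y]. *)
Lemma dotv_le x y : dotv x y <= enorm x * enorm y.
Proof.
have [x0|xn0] := eqVneq (enorm x) 0.
  have z k : x k ord0 = 0.
    have /eqP := sqr_enorm x; rewrite x0 expr0n eq_sym psumr_eq0 => [|l _]; last exact: sqr_ge0.
    by move=> /allP/(_ k); rewrite mem_index_enum sqrf_eq0 => /(_ isT)/eqP.
  by rewrite x0 mul0r /dotv big1 // => k _; rewrite z mul0r.
have [y0|yn0] := eqVneq (enorm y) 0.
  have z k : y k ord0 = 0.
    have /eqP := sqr_enorm y; rewrite y0 expr0n eq_sym psumr_eq0 => [|l _]; last exact: sqr_ge0.
    by move=> /allP/(_ k); rewrite mem_index_enum sqrf_eq0 => /(_ isT)/eqP.
  by rewrite y0 mulr0 /dotv big1 // => k _; rewrite z mulr0.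
set a := enorm x; set b := enorm y.
have ab : 0 < a * b by rewrite mulr_gt0 // lt_neqAle eq_sym ?xn0 ?yn0 enorm_ge0.
have : 0 <= \sum_k (x k ord0 * b - y k ord0 * a) ^+ 2.
  by apply: sumr_ge0 => k _; exact: sqr_ge0.
have -> : \sum_k (x k ord0 * b - y k ord0 * a) ^+ 2 =
    b ^+ 2 * \sum_k x k ord0 ^+ 2 + a ^+ 2 * \sum_k y k ord0 ^+ 2
      - 2 * (a * b) * dotv x y.
  by rewrite !mulr_sumr -big_split -sumrB; apply: eq_bigr => k _ /=; ring.
rewrite -!sqr_enorm -/a -/b.
have -> : b ^+ 2 * a ^+ 2 + a ^+ 2 * b ^+ 2 - 2 * (a * b) * dotv x y
  = 2 * (a * b) * (a * b - dotv x y) by ring.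
by rewrite pmulr_rge0 ?subr_ge0 // mulr_gt0.
Qed.

Lemma enormD x y : enorm (x + y) <= enorm x + enorm y.
Proof.
rewrite -(@ler_pXn2r _ 2) ?nnegrE ?addr_ge0 ?enorm_ge0 //.
rewrite sqrrD !sqr_enorm.
have -> : \sum_k (x + y) k ord0 ^+ 2 =
    \sum_k x k ord0 ^+ 2 + dotv x y *+ 2 + \sum_k y k ord0 ^+ 2.
  rewrite -sumrMnl -!big_split; apply: eq_bigr => k _ /=.
  by rewrite mxE sqrrD.
by rewrite lerD2r lerD2l lerMn2r dotv_le.
Qed.

Lemma entry_le_enorm (m n : nat) (B : 'M[R]_(m, n)) i j : `|B i j| <= enorm B.
Proof.
rewrite -sqrtr_sqr ler_wsqrtr // (bigD1 i) //= (bigD1 j) //= -addrA lerDl.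
rewrite addr_ge0 ?sumr_ge0 // => [k _|k _]; first exact: sqr_ge0.
by apply: sumr_ge0 => l _; exact: sqr_ge0.
Qed.

Lemma l1norm_le_enorm x : l1norm x <= N%:R * enorm x.
Proof.
apply: (le_trans (ler_sum _ (fun k _ => entry_le_enorm x k ord0))).
by rewrite sumr_const card_ord mulr_natl.
Qed.

Lemma enorm_le_l1norm x : enorm x <= l1norm x.
Proof.
rewrite -(@ler_pXn2r _ 2) ?nnegrE ?enorm_ge0 ?l1norm_ge0 //.
rewrite sqr_enorm expr2 mulr_suml; apply: ler_sum => k _.
rewrite -real_normK ?num_real // expr2 ler_wpM2l //.
by rewrite /l1norm (bigD1 k) //= lerDl sumr_ge0.
Qed.

Lemma open_enorm_ball x (r : R) : open [set z | enorm (z - x) < r].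
Proof.
rewrite openE => z /= zr; apply/nbhs_ballP.
have N1 : 0 < N%:R + 1 :> R by rewrite ltr_wpDl.
exists ((r - enorm (z - x)) / (N%:R + 1)); first by rewrite /= divr_gt0 // subr_gt0.
move=> y; rewrite -ball_normE /= distrC ltr_pdivlMr // => yz.
have -> : y - x = (y - z) + (z - x) by rewrite addrA subrK.
apply: (le_lt_trans (enormD _ _)); rewrite -ltrBrDr; apply: le_lt_trans yz.
apply: (le_trans (enorm_le_l1norm _)).
rewrite mulrDr mulr1 -[leLHS]addr0 lerD // mulr_natr -[X in _ *+ X]card_ord -sumr_const.
apply: ler_sum => k _; rewrite [`|y - z|]mx_normrE.
exact: (le_bigmax 0 (fun i : 'I_N * 'I_1 => `|(y - z) i.1 i.2|) (k, ord0)).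
Qed.

Lemma dist_le x y S : S y -> (dist x S <= (enorm (x - y))%:E)%E.
Proof. by move=> Sy; apply: ereal_inf_lbound; exists y. Qed.

Lemma dist_ge_shift x z S (r : R) :
  ((r + enorm (z - x))%:E <= dist x S)%E -> (r%:E <= dist z S)%E.
Proof.
move=> rx; apply: le_ereal_inf_tmp => _ [y Sy <-]; rewrite lee_fin.
have := le_trans rx (dist_le x Sy); rewrite lee_fin -lerBrDr => /le_trans; apply.
have -> : x - y = (x - z) + (z - y) by rewrite addrA subrK.
by rewrite lerBlDr [enorm (z - x)]enormB addrC enormD.
Qed.

Lemma open_bd S : open S -> bd S = closure S `\` S.
Proof. by move=> /interior_id oS; rewrite /bd oS. Qed.

(** The parameters of the points of the segment in [S] would otherwise form a
    proper clopen subset of the unit interval. *)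
Lemma segment_meets_bd S x z : open S -> S x -> ~ S z ->
  exists2 q : R, 0 <= q <= 1 & bd S (x + q *: (z - x)).
Proof.
move=> oS Sx Sz; apply: contrapT => noq.
pose g (q : R) : cV := x + q *: (z - x).
have cg : continuous g.
  move=> q; apply: cvgD; first exact: cvg_cst.
  by apply: cvgZl; exact: cvg_id.
have inside q : 0 <= q <= 1 -> closure S (g q) -> S (g q).
  move=> q01 cS; apply: contrapT => nS; apply: noq; exists q => //.
  by rewrite open_bd.
have := @segment_connected R 0 1 (`[0, 1] `&` g @^-1` S).
move=> /(_ _ _ _)/seteqP[|||_ /(_ 1)].
- by exists 0; split; rewrite /= ?in_itv/= ?lexx ?ler01 // /g scale0r addr0.
- by exists (g @^-1` S) => //; exact: open_comp.
- exists (g @^-1` closure S); first by apply: closed_comp => // *; exact: closed_closure.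
  apply/seteqP; split=> q /= [q01 Sq]; split=> //; first exact: subset_closure.
  by apply: inside => //; move: q01; rewrite in_itv.
- rewrite /= in_itv/= lexx ler01 => /(_ isT)[_]; rewrite /g scale1r.
  by rewrite addrC subrK.
Qed.

(** A segment that leaves [S] crosses the boundary, which is too far away for
    that. *)
Lemma ball_inner S x z (e r : R) : open S -> S x -> 0 <= e ->
  ((e + r)%:E <= dist x (bd S))%E -> enorm (z - x) < r -> inner S e z.
Proof.
move=> oS Sx e0 er zr; split; last first.
  apply: (@lt_le_trans _ _ (e + (r - enorm (z - x)))%:E).
    by rewrite lte_fin ltrDl subr_gt0.
  by apply: (@dist_ge_shift x); rewrite -addrA subrK.
apply: contrapT => nSz; have [q /andP[q0 q1] bq] := segment_meets_bd oS Sx nSz.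
have := le_trans er (dist_le x bq); rewrite lee_fin leNgt => /negP; apply.
rewrite opprD addrA subrr add0r enormN enormZ ger0_norm //.
apply: (@le_lt_trans _ _ (enorm (z - x))); first by rewrite ler_piMl // enorm_ge0.
by rewrite (lt_le_trans zr) // lerDr.
Qed.

(** A bounded set has an outer point, and the segment towards it crosses the
    boundary. *)
Lemma bd_nonempty S : (1 <= N)%N -> open S -> S !=set0 -> bounded_set S -> bd S !=set0.
Proof.
move=> N1 oS [x Sx] [M [_ Mb]].
have [z Sz] : exists z, ~ S z.
  pose k : 'I_N := Ordinal N1.
  have Mlt : M < `|M| + 2^-1 by rewrite (le_lt_trans (ler_norm M)) // ltrDl.
  pose c := `|M| + 1; exists (c *: @unit_vec R N k) => Sc.
  have b : `|c *: @unit_vec R N k| <= `|M| + 2^-1 := Mb _ Mlt _ Sc.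
  rewrite [`|c *: _|]mx_normrE in b.
  have := le_trans (le_bigmax 0 (fun i : 'I_N * 'I_1 => `|(c *: @unit_vec R N k) i.1 i.2|) (k, ord0)) b.
  rewrite /= !mxE !eqxx mulr1 ger0_norm /c; last by rewrite addr_ge0.
  by have := normr_ge0 M; lra.
have [q _ bq] := segment_meets_bd oS Sx Sz.
by exists (x + q *: (z - x)).
Qed.

End EuclideanNorm.

(** * Piecewise linear interpolation *)

Section Interpolation.
Context {R : realType} {N : nat}.
Local Notation cV := 'cV[R]_N.
Implicit Types (m : mesh R N).

(** A hull is the linear image of a compact set of barycentric coordinates. *)
Lemma closed_hull m (E : {set 'I_(nv m)}) : closed (hull E).
Proof.
pose C : set 'rV[R]_(nv m) := [set v | forall k, `[(0 : R), 1]%classic (v ord0 k)]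
  `&` [set v | \sum_(k in E) v ord0 k = 1].
pose b (v : 'rV[R]_(nv m)) : cV := \sum_(k in E) v ord0 k *: vtx k.
have cb : continuous b.
  apply: continuous_big => [|k _ v]; first exact: add_continuous.
  by have /cvgZl := @coord_continuous R 1 (nv m) ord0 k v; exact.
have -> : hull E = b @` C.
  apply/seteqP; split=> y.
    move=> [lam [lam0 lam1 ->]].
    have lamE k : k \in E -> lam k <= 1.
      by move=> kE; rewrite -lam1 (bigD1 k) //= lerDl sumr_ge0.
    exists (\row_k (if k \in E then lam k else 0)).
      split=> [k|] /=.
        rewrite mxE in_itv /=; case: ifP => [kE|_]; last by rewrite lexx ler01.
        by rewrite lam0 lamE.
      by rewrite -[RHS]lam1; apply: eq_bigr => k kE; rewrite mxE kE.
    by apply: eq_bigr => k kE; rewrite mxE kE.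
  move=> [v [v01 v1] <-]; exists (v ord0); split=> // k.
  by have := v01 k; rewrite /= in_itv /= => /andP[].
apply: compact_closed; first exact: norm_hausdorff.
apply: continuous_compact; first exact: continuous_subspaceT.
apply: compact_closedI.
  by apply: (@rV_compact R _ (fun _ => `[(0 : R), 1]%classic)) => _; exact: segment_compact.
apply: (@closed_comp _ _ (fun v : 'rV[R]_(nv m) => \sum_(k in E) v ord0 k) [set 1]).
  move=> v _; apply: (@continuous_big _ _ +%R) => [|k _]; first exact: add_continuous.
  exact: coord_continuous.
exact: closed_eq.
Qed.

Lemma closure_meshdom_hull m y : closure (meshdom m) y ->
  exists2 E, E \in elts m & hull E y.
Proof.
pose H := \bigcup_(E in [set` elts m]) hull E.
have cH : closed H by apply: closed_bigcup => // E _; exact: closed_hull.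
move=> cy; have [E /= mE hE] : H y.
  by rewrite (closure_id H).1 //; apply: closureS cy; exact: interior_subset.
by exists E.
Qed.

(** An affine function is determined on a simplex by its values at the vertices,
    so the nodal basis gives back the barycentric coordinates. *)
Lemma nodal_barycentric m y : triangulation m -> closure (meshdom m) y ->
  [/\ forall k, 0 <= @psi _ _ m k y, \sum_k @psi _ _ m k y = 1
    & \sum_k @psi _ _ m k y *: vtx k = y].
Proof.
move=> Tm /closure_meshdom_hull[E mE [lam [lam0 lam1 yE]]].
have hv l : l \in E -> hull E (vtx l).
  move=> lE; exists (fun k => (k == l)%:R); split=> [k||].
  - exact: ler0n.
  - rewrite (bigD1 l) //= eqxx big1 ?addr0 // => k /andP[_ /negPf ->] //.
  - rewrite (bigD1 l) //= eqxx scale1r big1 ?addr0 // => k /andP[_ /negPf ->].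
    by rewrite scale0r.
have psiE k : @psi _ _ m k y = if k \in E then lam k else 0.
  have [_ /(_ E mE)[c [b cb]]] := psi_P1 Tm k.
  have -> : @psi _ _ m k y = \sum_(l in E) lam l * @psi _ _ m k (vtx l).
    rewrite cb; last by exists lam.
    rewrite (eq_bigr (fun l => lam l * dotv c (vtx l) + lam l * b)); last first.
      by move=> l lE; rewrite cb ?mulrDr //; exact: hv.
    rewrite big_split -mulr_suml lam1 mul1r /=; congr (_ + _).
    rewrite yE /dotv; under [LHS]eq_bigr do rewrite summxE mulr_sumr.
    rewrite [LHS]exchange_big /=; apply: eq_bigr => l _; rewrite [RHS]mulr_sumr.
    by apply: eq_bigr => i _; rewrite mxE mulrCA.
  under eq_bigr do rewrite psi_nodal //.
  case: ifP => kE.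
    rewrite (bigD1 k) //= eqxx mulr1 big1 ?addr0 // => l /andP[_].
    by rewrite eq_sym => /negPf ->; rewrite mulr0.
  rewrite big1 // => l lE; case: eqP => [kl|_]; last by rewrite mulr0.
  by rewrite kl lE in kE.
split=> [k||].
- by rewrite psiE; case: ifP.
- by rewrite -[RHS]lam1 [RHS]big_mkcond; apply: eq_bigr => k _; rewrite psiE.
- rewrite [RHS]yE [RHS]big_mkcond; apply: eq_bigr => k _; rewrite psiE.
  by case: ifP => // _; rewrite scale0r.
Qed.

(** The interpolation weights reproduce affine functions at [ph m y], which
    leaves the second-order remainders at the vertices and the displacement
    [ph m y - y]. *)
Lemma Isp_error m (Phi : 'I_(nv m) -> R) (y : cV) (f G e : R) (g : 'I_N -> R) :
  triangulation m -> closure (meshdom m) (ph m y) ->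
  (forall l, interp_vtx y l ->
     `|Phi l - f - \sum_k (vtx l - y) k ord0 * g k| <= e) ->
  (forall k, `|g k| <= G) ->
  `|Isp Phi y - f| <= e + l1norm (ph m y - y) * G.
Proof.
move=> Tm cy Phie gG.
have [w0 w1 wy] := nodal_barycentric Tm cy.
have wd : \sum_l @psi _ _ m l (ph m y) *: (vtx l - y) = ph m y - y.
  under eq_bigr do rewrite scalerBr.
  by rewrite sumrB wy -scaler_suml w1 scale1r.
have e1 : Isp Phi y - f =
    \sum_l @psi _ _ m l (ph m y) * (Phi l - f - \sum_k (vtx l - y) k ord0 * g k)
    + \sum_k (ph m y - y) k ord0 * g k.
  have -> : \sum_k (ph m y - y) k ord0 * g k =
      \sum_l @psi _ _ m l (ph m y) * \sum_k (vtx l - y) k ord0 * g k.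
    under [RHS]eq_bigr do rewrite mulr_sumr.
    rewrite [RHS]exchange_big /=; apply: eq_bigr => k _.
    rewrite -wd summxE mulr_suml.
    by apply: eq_bigr => l _; rewrite mxE mulrA.
  rewrite -big_split /= /Isp -[f in LHS]mul1r -w1 mulr_suml -sumrB.
  by apply: eq_bigr => l _; ring.
rewrite e1; apply: (le_trans (ler_normD _ _)); apply: lerD; last exact: sum_l1_le.
apply: (le_trans (ler_norm_sum _ _ _)); rewrite -[e]mul1r -w1 mulr_suml.
apply: ler_sum => l _; rewrite normrM ger0_norm //.
have [-> | wn0] := eqVneq (@psi _ _ m l (ph m y)) 0; first by rewrite !mul0r.
by rewrite ler_wpM2l // Phie // /interp_vtx lt_neqAle eq_sym wn0 w0.
Qed.

Lemma meshsize_ge0 m : 0 <= meshsize m.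
Proof.
rewrite /meshsize; elim/big_rec: _ => // E x _ x0.
by rewrite le_max x0 orbT.
Qed.

End Interpolation.

(** * Smooth test functions *)

Section TestFunctionFacts.
Context {R : realType} {N : nat}.
Local Notation cV := 'cV[R]_N.
Implicit Types (I : set R) (U V : set cV) (phi : R -> cV -> R).

Lemma within_continuous_comp (T1 T2 T3 : topologicalType) (A : set T1) (B : set T2)
    (f : T2 -> T3) (j : T1 -> T2) :
  {within B, continuous f} -> continuous j -> (forall x, A x -> B (j x)) ->
  {within A, continuous (fun x => f (j x))}.
Proof.
move=> /subspace_continuousP cf cj AB; apply/subspace_continuousP => x Ax.
apply: cvg_comp (cf _ (AB _ Ax)) => P; rewrite !withinE /= => -[Q nQ PQ].
exists (j @^-1` Q); first exact: cj.
apply/seteqP; split=> y /= [Py Ay]; split=> //.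
  have : (P `&` B) (j y) by split => //; exact: AB.
  by rewrite PQ => -[].
have : (Q `&` B) (j y) by split => //; exact: AB.
by rewrite -PQ => -[].
Qed.

Lemma sup_norm_le (W : zmodType) (nrm : W -> R) I U (g : R -> cV -> W) (K : R) t x :
  (sup_norm nrm I U g <= K%:E)%E -> I t -> U x -> nrm (g t x) <= K.
Proof.
move=> gK It Ux; rewrite -lee_fin; apply: le_trans gK.
by apply: ereal_sup_ubound; exists (t, x).
Qed.

Lemma sup_norm_ge0 (W : zmodType) (nrm : W -> R) I U (g : R -> cV -> W) t x :
  (forall w, 0 <= nrm w) -> I t -> U x -> (0 <= sup_norm nrm I U g)%E.
Proof.
move=> nrm0 It Ux; apply: (@le_trans _ _ (nrm (g t x))%:E); first by rewrite lee_fin.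
by apply: ereal_sup_ubound; exists (t, x).
Qed.

(** Spatial derivatives, at a fixed time, of the [q]-th time derivative. *)
Definition space_family I phi (q : nat) (t : R) (w : seq 'I_N) : cV -> R :=
  partials I (map Some w ++ nseq q None) phi t.

Lemma smooth_space_family I U V phi q t : smooth I U phi -> open V -> V `<=` U ->
  I t -> partial_family V (space_family I phi q t).
Proof.
move=> sm oV VU It w x Vx; have [dw cw] := sm (map Some w ++ nseq q None); split.
  by move=> k; apply/derivableP; exact: dw (Some k) t x It (VU x Vx).
have : {within V, continuous (space_family I phi q t w)}.
  apply: (within_continuous_comp (j := fun y => (t, y)) cw).
    by move=> y; exact: (@cvg_pair _ _ _ (nbhs y) (nbhs t) (nbhs y) _ _ _ (fun=> t) id (cvg_cst _) cvg_id).
  by move=> y Vy; split=> //; exact: VU.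
by rewrite continuous_open_subspace // => /(_ x); rewrite inE; exact.
Qed.

Lemma perm_count_enum (T : finType) (w : seq T) :
  perm_eq w (flatten [seq nseq (count_mem k w) k | k <- enum T]).
Proof.
apply/allP => x _ /=; rewrite count_flatten -map_comp sumnE big_map big_enum /=.
rewrite (bigD1 x) //= count_nseq /= eqxx mul1n big1 ?addn0 // => k /negPf kx.
by rewrite count_nseq /= kx.
Qed.

(** Mixed derivatives may be reordered, so the bounds on the derivatives taken
    in the order fixed by [Dxt] hold for all words. *)
Lemma space_family_le I U V phi q t w x (B : nat -> R) :
  smooth I U phi -> open V -> V `<=` U -> I t -> V x ->
  (forall (alpha : {ffun 'I_N -> nat}), msize alpha = size w ->
    (sup_norm Num.norm I U (Dxt I alpha q phi) <= (B (size w))%:E)%E) ->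
  `|space_family I phi q t w x| <= B (size w).
Proof.
move=> sm oV VU It Vx bd.
have FV := smooth_space_family q sm oV VU It.
rewrite (family_perm oV FV (perm_count_enum w) Vx).
pose alpha := [ffun k : 'I_N => count_mem k w].
have sa : msize alpha = size w.
  rewrite (perm_size (perm_count_enum w)) size_flatten /shape -map_comp sumnE.
  by rewrite big_map big_enum /=; apply: eq_bigr => k _; rewrite ffunE size_nseq.
have := sup_norm_le (bd alpha sa) It (VU x Vx).
rewrite /space_family map_flatten -map_comp /Dxt.
congr (`|partials I (flatten _ ++ _) phi t x| <= _).
by apply: eq_map => k /=; rewrite ffunE map_nseq.
Qed.

Section Time.
Variables (a b : R) (u u1 : R -> R).
Hypothesis lim_quot : forall t, `[a, b]%classic t ->
  (fun s => (u s - u t) / (s - t)) @ within `[a, b]%classic (t^') --> u1 t.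

(** At an inner point the restriction of the difference quotient to the interval
    does not change its limit. *)
Lemma is_derive_time t : t \in `]a, b[ -> is_derive t 1 u (u1 t).
Proof.
move=> tab; have tI : `[a, b]%classic t by rewrite /= in_itv /=; move: tab;
  rewrite in_itv /= => /andP[? ?]; rewrite !ltW.
suff C : (fun h : R => h^-1 *: ((u \o shift t) (h *: (1 : R)) - u t)) @ 0^' --> u1 t.
  by split; [apply/cvg_ex; exists (u1 t) | apply: cvg_lim].
have -> : (fun h : R => h^-1 *: ((u \o shift t) (h *: (1 : R)) - u t)) =
    (fun s => (u s - u t) / (s - t)) \o (fun h => h + t).
  apply/funext => h /=; rewrite addrK -[h *: 1]/(h * 1) mulr1.
  by rewrite -[LHS]/(h^-1 * _) mulrC.
apply: cvg_comp (lim_quot tI) => P [e /= e0 eP].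
have [d d0 dI] : exists2 d : R, 0 < d & forall s, `|s - t| < d -> `[a, b]%classic s.
  move: tab; rewrite in_itv /= => /andP[at_ tb].
  exists (Num.min (t - a) (b - t)); first by rewrite lt_min !subr_gt0 at_ tb.
  move=> s; rewrite lt_min !ltr_norml => /andP[/andP[? ?] /andP[? ?]].
  by rewrite /= in_itv /=; lra.
exists (Num.min d e); first by rewrite /= lt_min d0.
move=> h; rewrite /= sub0r normrN lt_min => /andP[hd he] h0.
apply: eP => /=.
- have -> : t - (h + t) = - h by ring.
  by rewrite normrN.
- by rewrite -subr_eq0 addrK.
- by apply: dI; rewrite addrK.
Qed.

Lemma time_mvt c : {within `[a, b], continuous u} -> `[a, b]%classic c ->
  exists2 s, `[a, c]%classic s & u c - u a = u1 s * (c - a).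
Proof.
move=> cu /=; rewrite in_itv /= => /andP[ac cb].
have [t||s sac E] := @MVT_segment R u u1 a c ac; last by exists s.
  rewrite in_itv /= => /andP[at_ tc]; apply: is_derive_time.
  by rewrite in_itv /= at_ (lt_le_trans tc).
apply: continuous_subspaceW cu => t /=; rewrite !in_itv /= => /andP[-> tc].
exact: le_trans tc cb.
Qed.

End Time.

Lemma time_taylor2 (a b : R) (u u1 u2 : R -> R) (K : R) : a <= b ->
  (forall t, `[a, b]%classic t ->
    (fun s => (u s - u t) / (s - t)) @ within `[a, b]%classic (t^') --> u1 t) ->
  (forall t, `[a, b]%classic t ->
    (fun s => (u1 s - u1 t) / (s - t)) @ within `[a, b]%classic (t^') --> u2 t) ->
  {within `[a, b], continuous u} -> {within `[a, b], continuous u1} ->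
  (forall t, `[a, b]%classic t -> `|u2 t| <= K) ->
  `|u b - u a - (b - a) * u1 a| <= (b - a) ^+ 2 * K.
Proof.
move=> ab lu lu1 cu cu1 K2.
have bI : `[a, b]%classic b by rewrite /= in_itv /= ab lexx.
have [s sI ->] := time_mvt lu cu bI.
have [s' s'I E] := time_mvt lu1 cu1 sI.
have s2I : `[a, b]%classic s'.
  move: sI s'I; rewrite /= !in_itv /= => /andP[_ sb] /andP[-> s's].
  exact: le_trans s's sb.
rewrite mulrC -mulrBr E normrM ger0_norm ?subr_ge0 // expr2 -mulrA ler_wpM2l ?subr_ge0 //.
rewrite normrM mulrC; apply: ler_pM => //; last exact: K2.
by move: sI; rewrite /= in_itv /= => /andP[as_ sb]; rewrite ger0_norm ?subr_ge0 // lerB.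
Qed.

Lemma smooth_time_taylor U phi (a b : R) (x : cV) (K : R) : a <= b ->
  let I := `[a, b]%classic in
  smooth I U phi -> U x ->
  (forall t, I t -> `|space_family I phi 2 t [::] x| <= K) ->
  `|phi b x - phi a x - (b - a) * space_family I phi 1 a [::] x| <= (b - a) ^+ 2 * K.
Proof.
move=> ab I sm Ux K2.
have ct q : {within `[a, b], continuous (fun t => space_family I phi q t [::] x)}.
  apply: (within_continuous_comp (j := fun t => (t, x)) (sm (nseq q None)).2).
    by move=> y; exact: (@cvg_pair _ _ _ (nbhs y) (nbhs y) (nbhs x) _ _ _ id (fun=> x) cvg_id (cvg_cst _)).
  by move=> t It; split.
have lt q t : I t -> (fun s => (space_family I phi q s [::] x - space_family I phi q t [::] x)
    / (s - t)) @ within I (t^') --> space_family I phi q.+1 t [::] x.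
  by move=> It; exact: (sm (nseq q None)).1 None t x It Ux.
exact: (@time_taylor2 a b (fun t => space_family I phi 0 t [::] x)
  (fun t => space_family I phi 1 t [::] x)
  (fun t => space_family I phi 2 t [::] x) K ab (lt 0%N) (lt 1%N) (ct 0%N) (ct 1%N) K2).
Qed.

End TestFunctionFacts.

(** * Coefficients and cubature *)

(** Bound, in the [l1] norm, for the drift and for every cubature displacement. *)
Definition step_size (R : realType) (N p M : nat) (Q : cubature R p M) (K0 : R) : R :=
  N%:R * K0 * (1 + \sum_j l1norm (Defs.eta Q j)).

Section Coefficients.
Context {R : realType} {N p M : nat} {A : metricType R}.
Variables (P : problem R N p A) (Q : cubature R p M) (K0 : R).
Hypotheses (N_ge1 : (1 <= N)%N) (HP : problem_ok P K0) (HQ : cubature_ok Q).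

(** The bound on the coefficients is read off a sum of suprema: no term may be
    [-oo], which for the boundary datum requires a boundary point. *)
Lemma coefficients_le t x a : times P t -> closure (dom P) x ->
  [/\ enorm (sigma P t x a) <= K0, enorm (mu P t x a) <= K0,
      `|rate P t x a| <= K0 & `|source P t x a| <= K0].
Proof.
move=> It cx; have [oD _ D0 bD] := ok_dom HP.
have [b0 Db0] := bd_nonempty N_ge1 oD D0 bD.
have psi0 : (0 <= ereal_sup [set (`|Psi P x|)%:E | x in closure (dom P)])%E.
  apply: (@le_trans _ _ (`|Psi P x|)%:E); first by rewrite lee_fin.
  by apply: ereal_sup_ubound; exists x.
have u0 : (0 <= sup_norm Num.norm (times P) (bd (dom P)) (u_bd P))%E.
  exact: (sup_norm_ge0 (u_bd P) (@normr_ge0 _ _) It Db0).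
have := ok_bound HP; set rg := ereal_sup (range _) => bound.
have cK : (coef_sup P a <= K0%:E)%E.
  apply: le_trans bound; apply: (@le_trans _ _ rg).
    by apply: ereal_sup_ubound; exists a.
  by rewrite leeDr // adde_ge0.
have en0 (m n : nat) (B : 'M[R]_(m, n)) : 0 <= enorm B by exact: sqrtr_ge0.
move: cK; rewrite /coef_sup.
set s1 := sup_norm _ _ _ _; set s2 := sup_norm _ _ _ _.
set s3 := sup_norm _ _ _ _; set s4 := sup_norm _ _ _ _ => cK.
have s1_ge0 : (0 <= s1)%E
  := sup_norm_ge0 (fun t x => sigma P t x a) (en0 _ _) It cx.
have s2_ge0 : (0 <= s2)%E
  := sup_norm_ge0 (fun t x => mu P t x a) (en0 _ _) It cx.
have s3_ge0 : (0 <= s3)%E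
  := sup_norm_ge0 (fun t x => rate P t x a) (@normr_ge0 _ _) It cx.
have s4_ge0 : (0 <= s4)%E
  := sup_norm_ge0 (fun t x => source P t x a) (@normr_ge0 _ _) It cx.
split.
- apply: (sup_norm_le (g := fun t x => sigma P t x a) _ It cx).
  by apply: le_trans cK; rewrite -!addeA leeDl // !adde_ge0.
- apply: (sup_norm_le (g := fun t x => mu P t x a) _ It cx).
  apply: le_trans cK; apply: (@le_trans _ _ (s1 + s2)%E); first by rewrite leeDr.
  by rewrite -addeA leeDl // adde_ge0.
- apply: (sup_norm_le (g := fun t x => rate P t x a) _ It cx).
  by apply: le_trans cK; rewrite addeAC leeDr // !adde_ge0.
- apply: (sup_norm_le (g := fun t x => source P t x a) _ It cx).
  by apply: le_trans cK; rewrite leeDr // !adde_ge0.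
Qed.

Local Notation step_size := (step_size N Q K0).

Let K0_ge0 : 0 <= K0. Proof. exact: ltW (ok_K0 HP). Qed.

Lemma step_size_ge0 : 0 <= step_size.
Proof.
by rewrite !mulr_ge0 // addr_ge0 // sumr_ge0 // => j _; exact: l1norm_ge0.
Qed.

Lemma drift_le t x a : times P t -> closure (dom P) x ->
  l1norm (mu P t x a) <= step_size.
Proof.
move=> It cx; have [_ muK _ _] := coefficients_le a It cx.
apply: (le_trans (l1norm_le_enorm _)); apply: (@le_trans _ _ (N%:R * K0)).
  by rewrite ler_wpM2l.
rewrite -[leLHS]mulr1 ler_wpM2l ?mulr_ge0 // lerDl sumr_ge0 // => j _.
exact: l1norm_ge0.
Qed.

Lemma noise_le t x a j : times P t -> closure (dom P) x ->
  l1norm (sigma P t x a *m Defs.eta Q j) <= step_size.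
Proof.
move=> It cx; have [sK _ _ _] := coefficients_le a It cx.
apply: (@le_trans _ _ (\sum_(k < N) K0 * l1norm (Defs.eta Q j))).
  apply: ler_sum => k _; rewrite mxE mulr_sumr; apply: (le_trans (ler_norm_sum _ _ _)).
  apply: ler_sum => l _; rewrite normrM ler_wpM2r //.
  by apply: le_trans sK; exact: entry_le_enorm.
rewrite sumr_const card_ord -mulr_natl mulrA ler_wpM2l ?mulr_ge0 //.
rewrite (bigD1 j) //= addrCA lerDl addr_ge0 // sumr_ge0 // => l _.
exact: l1norm_ge0.
Qed.

Lemma branch_speed_le t x a j : times P t -> closure (dom P) x ->
  enorm (mu P t x a) + enorm (sigma P t x a *m Defs.eta Q j) <= BC P Q - 1.
Proof.
move=> It cx; rewrite /BC addrAC subrr add0r; apply: ub_le_sup; last first.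
  by exists t, x, a, j.
exists (step_size + step_size) => _ [t' [x' [a' [j' [It' cx' ->]]]]].
apply: lerD; apply: (le_trans (enorm_le_l1norm _)).
  exact: drift_le.
exact: noise_le.
Qed.

(** The matrices [rho_j (S eta_j) (S eta_j)^T] add up to [S S^T], because the
    cubature has the covariance of a standard Gaussian vector. *)
Lemma cubature_trace (S : 'M[R]_(N, p)) (H : 'M[R]_N) :
  \sum_j rho Q j * (\sum_k (S *m Defs.eta Q j) k ord0 *
     \sum_l (S *m Defs.eta Q j) l ord0 * H l k) = \tr (S *m S^T *m H).
Proof.
have -> : S *m S^T = \sum_j rho Q j *: ((S *m Defs.eta Q j) *m (S *m Defs.eta Q j)^T).
  have -> : S *m S^T = S *m 1%:M *m S^T by rewrite mulmx1.
  rewrite -(eta_cov HQ) mulmx_sumr mulmx_suml.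
  by apply: eq_bigr => j _; rewrite -scalemxAr -scalemxAl trmx_mul !mulmxA.
rewrite mulmx_suml raddf_sum; apply: eq_bigr => j _ /=.
rewrite -scalemxAl mxtraceZ; congr (_ * _); move: (S *m _) => v.
rewrite /mxtrace; apply: eq_bigr => k _; rewrite [RHS]mxE mulr_sumr.
by apply: eq_bigr => l _; rewrite [(v *m _) _ _]mxE big_ord1 [_^T _ _]mxE mulrA.
Qed.

End Coefficients.

(** * Consistency of one row of the scheme *)

(** Coefficient of [Dt ^ 2 * Creg * eps ^- 3] in the error of a pair of opposite
    branches: the three groups come from the expansion in time, from the time
    derivative at the displaced points, and from the expansion in space. *)
Definition pair_const (R : realType) (L : R) : R :=
  1 + (L + L ^+ 2) + (L ^+ 2 + L ^+ 3 + L ^+ 4).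

Definition interp_const (R : realType) (N : nat) (Cp Cpatch Creg : R) : R :=
  Creg * ((N%:R * Cpatch) ^+ 2 + N%:R * Cp).

Definition row_const (R : realType) (N p M : nat) (Q : cubature R p M)
    (K0 Cp Cpatch Creg : R) : R :=
  let L := step_size N Q K0 in
  Creg * (pair_const L + K0 * (1 + L + L ^+ 2 + K0)) + interp_const N Cp Cpatch Creg.

Section Row.
Context {R : realType} {N p M : nat} {A : metricType R}.
Variables (P : problem R N p A) (Q : cubature R p M) (K0 Cbd Cp Cpatch : R).
Hypotheses (N_ge1 : (1 <= N)%N) (M_ge1 : (1 <= M)%N) (HP : problem_ok P K0) (HQ : cubature_ok Q).
Hypotheses (Cp_ge0 : 0 <= Cp) (Cpatch_ge0 : 0 <= Cpatch).
Variables (m : mesh R N) (Nt : nat) (eps : R) (n : nat) (i : 'I_(nv m)).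
Hypothesis Hm : mesh_ok P Q m Nt Cbd Cp Cpatch.
Local Notation h := (meshsize m).
Local Notation Dt := (dt P Nt).
Local Notation s := (Num.sqrt Dt).
Local Notation x := (vtx i).
Local Notation t := (tn P Nt n).
Local Notation T := (tn P Nt n.+1).
Local Notation I := (`[t, T]%classic).
Local Notation mu_ a := (mu P t x a).
Local Notation noise a j := (sigma P t x a *m Defs.eta Q j).
Local Notation Lam := (step_size N Q K0).
Hypotheses (Dt01 : 0 < Dt <= 1) (eps01 : 0 < eps <= 1) (n_lt : (n < Nt)%N).
Hypothesis xO : dom P x.
Hypothesis x_far :
  ((2 * eps + BC P Q * s + Cpatch * h)%:E <= dist x (bd (dom P)))%E.

Let Dt_gt0 : 0 < Dt. Proof. by case/andP: Dt01. Qed.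
Let Dt_ge0 : 0 <= Dt. Proof. exact: ltW. Qed.
Let s_ge0 : 0 <= s. Proof. exact: sqrtr_ge0. Qed.
Let s_sqr : s * s = Dt. Proof. by rewrite -expr2 sqr_sqrtr. Qed.
Let s_le1 : s <= 1.
Proof. by rewrite -sqrtr1 ler_wsqrtr //; case/andP: Dt01. Qed.
Let eps_gt0 : 0 < eps. Proof. by case/andP: eps01. Qed.
Let eps_le1 : eps <= 1. Proof. by case/andP: eps01. Qed.
Let patch_ge0 : 0 <= Cpatch * h. Proof. by rewrite mulr_ge0 // meshsize_ge0. Qed.
Let oD : open (dom P). Proof. by case: (ok_dom HP). Qed.
Let xcl : closure (dom P) x. Proof. exact: subset_closure. Qed.

Lemma tnS : T = t + Dt.
Proof. by rewrite /tn -natr1 mulrDl mul1r. Qed.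

Let t_times : times P t.
Proof.
rewrite /times /= in_itv /=; have T0 := ok_horizon HP.
have Nt0 : 0 < Nt%:R :> R by rewrite ltr0n (leq_ltn_trans _ n_lt).
rewrite /tn mulr_ge0 //= /dt mulrCA ger_pMr // ler_pdivrMr // mul1r ler_nat ltnW //.
Qed.

Let speed_le a j : enorm (mu_ a) + enorm (noise a j) <= BC P Q - 1.
Proof. exact: (branch_speed_le Q N_ge1 HP). Qed.

Lemma displacement_le a j (c1 c2 : R) : `|c1| <= s -> `|c2| <= s ->
  enorm (c1 *: mu_ a + c2 *: noise a j) <= s * (BC P Q - 1).
Proof.
move=> c1s c2s; apply: (le_trans (enormD _ _)); rewrite !enormZ.
apply: (@le_trans _ _ (s * (enorm (mu_ a) + enorm (noise a j)))).
  by rewrite mulrDr; apply: lerD; rewrite ler_wpM2r // enorm_ge0.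
by rewrite ler_wpM2l.
Qed.

(** A convex open set containing every point at which the test function is
    expanded. *)
Definition row_ball : set 'cV[R]_N :=
  [set z | enorm (z - x) < eps + BC P Q * s + Cpatch * h].

Lemma row_ball_inner : row_ball `<=` inner (dom P) eps.
Proof.
move=> z zV; apply: (ball_inner oD xO (ltW eps_gt0)) zV.
by rewrite !addrA -mulr2n -mulr_natl.
Qed.

Lemma near_row_ball z : enorm (z - x) <= s * (BC P Q - 1) + Cpatch * h -> row_ball z.
Proof.
move=> zx; apply: (le_lt_trans zx); rewrite ltrD2r mulrBr mulr1 [s * _]mulrC.
by move: s_ge0 eps_gt0; lra.
Qed.

Lemma near_row_far z : enorm (z - x) <= s * (BC P Q - 1) + Cpatch * h ->
  ((2 * eps)%:E <= dist z (bd (dom P)))%E.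
Proof.
move=> zx; apply: (@dist_ge_shift _ _ x); apply: le_trans x_far; rewrite lee_fin.
rewrite -addrA lerD2l; apply: (le_trans zx); rewrite lerD2r mulrBr mulr1 [s * _]mulrC.
by move: s_ge0; lra.
Qed.

Lemma Gam_near a j b (q : R) : 0 < q <= Dt ->
  enorm (Gam P Q Nt n i a j b q - x) <= s * (BC P Q - 1).
Proof.
move=> /andP[q0 qDt]; rewrite /Gam addrC !addrA addNr add0r.
have sq : Num.sqrt q <= s by rewrite ler_wsqrtr.
apply: displacement_le.
  rewrite ger0_norm ?(ltW q0) // (le_trans qDt) // -[X in X <= _]s_sqr.
  by rewrite ler_piMl.
by rewrite normrM normr_sign mul1r ger0_norm // sqrtr_ge0.
Qed.

Lemma no_exit a j b : chi P Q Nt n i a j b = false.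
Proof.
apply/negbTE; rewrite negbK; apply/eqP/seteqP; split=> // q /= [q0 qO]; apply: qO.
suff /row_ball_inner[] : row_ball (Gam P Q Nt n i a j b q) by [].
by apply: near_row_ball; rewrite (le_trans (Gam_near _ _ _ q0)) // lerDl.
Qed.

Lemma full_exit_time a j b : exit_time P Q Nt n i a j b = Dt.
Proof. by rewrite /exit_time no_exit. Qed.

Lemma full_tau a : tau P Q Nt n i a = Dt.
Proof.
rewrite /tau /theta /root_time; under eq_bigr do rewrite !full_exit_time s_sqr.
by rewrite -mulr_suml (rho_sum HQ) mul1r invrK.
Qed.

Lemma full_omega a j b : omega P Q Nt n i a j b = rho Q j / 2.
Proof.
rewrite /omega full_tau /root_time !full_exit_time mulrDr s_sqr.
by field; apply/eqP; move: Dt_gt0; lra.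
Qed.

Local Notation y_ a j b := (Gam P Q Nt n i a j b Dt).

Lemma endpoint_near a j b : enorm (y_ a j b - x) <= s * (BC P Q - 1).
Proof. by apply: Gam_near; rewrite Dt_gt0 lexx. Qed.

(** At a grid node the only interpolation vertex is the node itself, so the
    patch condition is needed off the grid only. *)
Lemma interp_vtx_near a j b (l : 'I_(nv m)) : interp_vtx (y_ a j b) l ->
  enorm (vtx l - y_ a j b) <= Cpatch * h.
Proof.
move=> yl; have [[k _ ky]|nv] := pselect (range (@vtx _ _ m) (y_ a j b)).
  move: yl; rewrite /interp_vtx -ky (G4_ph_vtx Hm).
  rewrite (psi_nodal (mesh_triangulation Hm)); case: eqP => [-> _|]; last by rewrite ltxx.
  by rewrite subrr -(scale0r (vtx k)) enormZ normr0 mul0r.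
have [] // := G4_patch Hm (x := y_ a j b) (l := l) _ yl.
by split=> //; exists n, i, a, j, b; split; rewrite ?no_exit.
Qed.

Lemma interp_segment_near a j b (l : 'I_(nv m)) (q : R) : interp_vtx (y_ a j b) l -> 0 <= q <= 1 ->
  enorm (y_ a j b + q *: (vtx l - y_ a j b) - x) <= s * (BC P Q - 1) + Cpatch * h.
Proof.
move=> yl /andP[q0 q1]; rewrite addrAC; apply: (le_trans (enormD _ _)).
apply: lerD; first exact: endpoint_near.
rewrite enormZ ger0_norm //; apply: le_trans (interp_vtx_near yl).
by rewrite ler_piMl // enorm_ge0.
Qed.

Lemma interp_points_inner a j b y : interp_point P Q Nt n i a j b y ->
  ((2 * eps)%:E <= dist y (bd (dom P)))%E /\ inner (dom P) eps y.
Proof.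
move=> yI; suff yx : enorm (y - x) <= s * (BC P Q - 1) + Cpatch * h.
  by split; [exact: near_row_far | exact/row_ball_inner/near_row_ball].
case: yI => [->|[l yl ->]].
  by rewrite (le_trans (endpoint_near _ _ _)) // lerDl.
have i1 : 0 <= (1 : R) <= 1 by rewrite ler01 lexx.
by have := interp_segment_near yl i1; rewrite scale1r [y_ a j b + _]addrC subrK.
Qed.

Section Consistency.
Variables (phi : R -> 'cV[R]_N -> R) (Creg : R).
Hypothesis sm : smooth I (inner (dom P) eps) phi.
Hypothesis phi_le : (sup_norm Num.norm I (inner (dom P) eps) phi <= Creg%:E)%E.
Hypothesis Dphi_le : forall (alpha : {ffun 'I_N -> nat}) (q : nat),
  (1 <= msize alpha + 2 * q <= 6)%N ->
  (sup_norm Num.norm I (inner (dom P) eps) (Dxt I alpha q phi)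
     <= (Creg * eps ^ (1 - (msize alpha + 2 * q)%N%:Z))%:E)%E.

Local Notation F := (space_family I phi).

Let tI : I t. Proof. by rewrite /= in_itv /= lexx tnS lerDl. Qed.
Let TI : I T. Proof. by rewrite /= in_itv /= lexx tnS lerDl Dt_ge0. Qed.

Let open_V : open row_ball. Proof. exact: open_enorm_ball. Qed.

Let BC1 : 1 <= BC P Q.
Proof.
have [_ [a _]] := ok_A HP; pose j : 'I_M := Ordinal M_ge1.
rewrite -subr_ge0; apply: le_trans (speed_le a j).
by rewrite addr_ge0 // enorm_ge0.
Qed.

Let row_ball_center : row_ball x.
Proof.
apply: near_row_ball; rewrite subrr -(scale0r x) enormZ normr0 mul0r addr_ge0 //.
by rewrite mulr_ge0 // subr_ge0.
Qed.

Lemma eps_power_le (k l : nat) : (1 <= k <= l.+1)%N -> eps ^ (1 - k%:Z) <= eps ^- l.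
Proof.
case: k => // k; rewrite ltnS => kl.
have -> : 1 - k.+1%:Z = - k%:Z by rewrite -add1n PoszD; ring.
rewrite -exprnN lef_pV2 ?posrE ?exprn_gt0 //.
by apply: ler_wiXn2l => //; exact: ltW.
Qed.

Let Creg_ge0 : 0 <= Creg.
Proof.
apply: le_trans (sup_norm_le phi_le tI (row_ball_inner row_ball_center)).
exact: normr_ge0.
Qed.

(** The exponent is relaxed from the order of the derivative to any larger one,
    which is possible because [eps <= 1]. *)
Lemma word_le l q tau w y : (1 <= size w + 2 * q <= l.+1)%N -> (l <= 5)%N ->
  I tau -> row_ball y -> `|F q tau w y| <= Creg * eps ^- l.
Proof.
move=> /andP[wq1 wql] l5 It Vy.
apply: (@le_trans _ _ (Creg * eps ^ (1 - (size w + 2 * q)%N%:Z))).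
  apply: (space_family_le (B := fun k => Creg * eps ^ (1 - (k + 2 * q)%N%:Z)) sm open_V
    row_ball_inner It Vy) => alpha sa.
  rewrite -sa; apply: Dphi_le; rewrite sa wq1 /=.
  exact: leq_trans wql _.
by rewrite ler_wpM2l // eps_power_le // wq1.
Qed.

Section Pair.
Variables (a : A) (j : 'I_M).

Local Notation u := (Dt *: mu_ a).
Local Notation v := (s *: noise a j).
Local Notation K := (Creg * eps ^- 3).
Local Notation J2 := (dir_iter (F 0 t) (noise a j) 2 [::] x).
Local Notation D1 := (F 1 t [::] x + dotv (mu_ a) (grad I phi t x)).

Let Gam_false : y_ a j false = x + u + v.
Proof. by rewrite /Gam expr0 mul1r. Qed.

Let Gam_true : y_ a j true = x + u - v.
Proof. by rewrite /Gam expr1 mulN1r scaleNr. Qed.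

Let endpoint_V b : row_ball (y_ a j b).
Proof. by apply: near_row_ball; rewrite (le_trans (endpoint_near _ _ _)) // lerDl. Qed.

Let branch_V q q' : -1 <= q <= 1 -> -1 <= q' <= 1 -> row_ball (x + q *: u + q' *: v).
Proof.
move=> q1 q'1; apply: near_row_ball.
rewrite addrC !addrA addNr add0r !scalerA.
apply: (@le_trans _ _ (s * (BC P Q - 1))); last by rewrite lerDl.
apply: displacement_le; rewrite normrM.
  rewrite [`|Dt|]ger0_norm // -[leRHS]mul1r; apply: ler_pM => //; first by rewrite ler_norml.
  by rewrite -[X in X <= _]s_sqr ler_piMl.
rewrite [`|s|]ger0_norm // -[leRHS]mul1r; apply: ler_pM => //; by rewrite ler_norml.
Qed.

Let Lam_ge0 : 0 <= Lam. Proof. exact: (step_size_ge0 Q HP). Qed.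

Let u_le : l1norm u <= Dt * Lam.
Proof. by rewrite l1normZ ger0_norm // ler_wpM2l // (drift_le Q N_ge1 HP). Qed.

Let v_le : l1norm v <= s * Lam.
Proof. by rewrite l1normZ ger0_norm // ler_wpM2l // (noise_le Q N_ge1 HP). Qed.

Let v2_le : l1norm v ^+ 2 <= Dt * Lam ^+ 2.
Proof.
rewrite -[X in _ <= X * _]s_sqr -expr2 -exprMn; apply: lerXn2r => //.
- by rewrite nnegrE l1norm_ge0.
- by rewrite nnegrE mulr_ge0.
Qed.

Let family q tau : I tau -> partial_family row_ball (F q tau).
Proof. exact: smooth_space_family sm open_V row_ball_inner. Qed.

(** The time step is taken at the end points, where it leaves the time derivative
    at displaced points; the pairing of opposite branches brings it back to the
    node at the cost of [Dt] only. *)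
Lemma pair_consistency :
  `|phi T (y_ a j false) + phi T (y_ a j true)
     - 2 * (phi t x + Dt * D1) - Dt * J2| <= 2 * (Dt ^+ 2 * (pair_const Lam * K)).
Proof.
have time b : `|phi T (y_ a j b) - phi t (y_ a j b) - Dt * F 1 t [::] (y_ a j b)|
    <= Dt ^+ 2 * K.
  have tT : t <= T by rewrite tnS lerDl.
  have := smooth_time_taylor tT sm (row_ball_inner (endpoint_V b)) (K := K).
  have -> : T - t = Dt by rewrite tnS addrC addKr.
  by apply=> tau It; apply: word_le.
have K_ge0 : 0 <= K by rewrite mulr_ge0 // invr_ge0 exprn_ge0 // ltW.
have tdrift : `|F 1 t [::] (y_ a j false) + F 1 t [::] (y_ a j true) - 2 * F 1 t [::] x|
    <= 2 * (Dt * ((Lam + Lam ^+ 2) * K)).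
  rewrite Gam_false Gam_true.
  apply: (le_trans (branch_pair_lipschitz open_V (family 1 tI) branch_V (K := K) _)).
    move=> w y ws Vy; apply: word_le => //.
    by move: ws; case: (size w) => [|[|[|[|[|?]]]]].
  by rewrite ler_wpM2l // [leRHS]mulrA ler_wpM2r // mulrDr lerD.
have space : `|phi t (y_ a j false) + phi t (y_ a j true)
    - 2 * (phi t x + Dt * dotv (mu_ a) (grad I phi t x)) - Dt * J2|
    <= 2 * (Dt ^+ 2 * ((Lam ^+ 2 + Lam ^+ 3 + Lam ^+ 4) * K)).
  have := branch_pair_expansion open_V (family 0 tI) branch_V (K := K) _.
  rewrite -Gam_false -Gam_true dir_iterZ [s ^+ 2]expr2 s_sqr.
  have -> : \sum_k u k ord0 * F 0 t [:: k] x = Dt * dotv (mu_ a) (grad I phi t x).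
    by rewrite mulr_sumr; apply: eq_bigr => k _; rewrite !mxE mulrA.
  move=> sp; apply: (le_trans (sp _)).
    move=> w y ws Vy; apply: word_le => //.
    by move: ws; case: (size w) => [|[|[|[|[|?]]]]].
  rewrite ler_wpM2l // [leRHS]mulrA ler_wpM2r // !mulrDr; apply: lerD; first apply: lerD.
  - by rewrite -exprMn lerXn2r ?nnegrE ?l1norm_ge0 // mulr_ge0.
  - have -> : Dt ^+ 2 * Lam ^+ 3 = (Dt * Lam) * (Dt * Lam ^+ 2) by ring.
    by apply: ler_pM; rewrite ?l1norm_ge0 ?exprn_ge0 ?l1norm_ge0.
  - have -> : l1norm v ^+ 4 = (l1norm v ^+ 2) ^+ 2 by rewrite -exprM.
    have -> : Dt ^+ 2 * Lam ^+ 4 = (Dt * Lam ^+ 2) ^+ 2 by ring.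
    by rewrite lerXn2r ?nnegrE ?exprn_ge0 ?l1norm_ge0 // mulr_ge0 // exprn_ge0.
have tdriftD : `|Dt * (F 1 t [::] (y_ a j false) + F 1 t [::] (y_ a j true)
    - 2 * F 1 t [::] x)| <= Dt * (2 * (Dt * ((Lam + Lam ^+ 2) * K))).
  by rewrite normrM ger0_norm // ler_wpM2l.
have := time false; have := time true.
move: tdriftD space => /ler_normlP[? ?] /ler_normlP[? ?] /ler_normlP[? ?] /ler_normlP[? ?].
rewrite /pair_const; apply/ler_normlP; split; lra.
Qed.

(** The gradient is bounded by [Creg] without any negative power of [eps], so the
    displacement [ph m y - y] of size [h ^ 2] costs no more than the second-order
    remainders, of size [h ^ 2 / eps]. *)
Lemma interp_consistency (phih : 'I_(nv m) -> R) b :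
  (forall l, interp_vtx (y_ a j b) l -> phih l = phi T (vtx l)) ->
  `|Isp phih (y_ a j b) - phi T (y_ a j b)| <= interp_const N Cp Cpatch Creg * (h ^+ 2 * eps^-1).
Proof.
move=> phihE; have h0 := meshsize_ge0 m.
have ycl : closure (dom P) (y_ a j b).
  by apply: subset_closure; have /row_ball_inner[] := endpoint_V b.
have e1 : 1 <= eps^-1 by rewrite invf_ge1.
have C1_ge0 : 0 <= Creg * eps^-1 by rewrite mulr_ge0 // invr_ge0 ltW.
apply: (le_trans (@Isp_error _ _ _ phih (y_ a j b) (phi T (y_ a j b)) Creg
  ((N%:R * (Cpatch * h)) ^+ 2 * (Creg * eps^-1))
  (fun k => F 0 T [:: k] (y_ a j b)) (mesh_triangulation Hm) (G4_ph_closure Hm ycl) _ _)).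
- move=> l yl; rewrite phihE //.
  have := family_taylor2 (w := [::]) open_V (family 0 TI) (x := y_ a j b) (v := vtx l - y_ a j b)
    (K := Creg * eps^-1).
  rewrite [y_ a j b + _]addrC subrK => tay; apply: (le_trans (tay _ _)).
  + by move=> q q01; apply: near_row_ball; exact: interp_segment_near.
  + move=> w y sw Vy; rewrite -[eps^-1]expr1 exprVn; apply: word_le => //; rewrite sw //.
  + rewrite ler_wpM2r // lerXn2r ?nnegrE ?l1norm_ge0 //.
      by rewrite mulr_ge0.
    apply: (le_trans (l1norm_le_enorm _)); rewrite ler_wpM2l //.
    exact: interp_vtx_near.
- move=> k; have := @word_le 0 0 T [:: k] (y_ a j b) isT isT TI (endpoint_V b).
  by rewrite expr0 invr1 mulr1.
have phy : l1norm (ph m (y_ a j b) - y_ a j b) <= N%:R * (Cp * h ^+ 2).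
  by apply: (le_trans (l1norm_le_enorm _)); rewrite ler_wpM2l // (G4_ph_dist Hm).
apply: (@le_trans _ _ ((N%:R * (Cpatch * h)) ^+ 2 * (Creg * eps^-1)
    + N%:R * (Cp * h ^+ 2) * (Creg * eps^-1))).
  rewrite lerD2l; apply: ler_pM => //; first exact: l1norm_ge0.
  by rewrite -[X in X <= _]mulr1 ler_wpM2l.
by rewrite /interp_const le_eqVlt; apply/orP; left; apply/eqP; ring.
Qed.

End Pair.

Section Control.
Variable (a : A).
Local Notation K := (Creg * eps ^- 3).
Local Notation H := (h ^+ 2 * eps^-1).
Local Notation J2 j := (dir_iter (F 0 t) (noise a j) 2 [::] x).
Local Notation D1 := (F 1 t [::] x + dotv (mu_ a) (grad I phi t x)).
Local Notation gen := (D1 + 2^-1 * \tr (sigma P t x a *m (sigma P t x a)^T *m hess I phi t x)).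

Lemma trace_J2 : \tr (sigma P t x a *m (sigma P t x a)^T *m hess I phi t x)
  = \sum_j rho Q j * J2 j.
Proof.
rewrite -(cubature_trace HQ); apply: eq_bigr => j _; congr (_ * _).
apply: eq_bigr => k _; congr (_ * _); apply: eq_bigr => l _.
by rewrite [hess _ _ _ _ _ _]mxE.
Qed.

Let weighted (g : 'I_M -> R) (B : R) :
  (forall j, `|g j| <= B) -> `|\sum_j rho Q j * g j| <= B.
Proof.
move=> gB; apply: (le_trans (ler_norm_sum _ _ _)).
rewrite -[B]mul1r -(rho_sum HQ) mulr_suml; apply: ler_sum => j _.
have r0 := ltW (rho_gt0 HQ j).
by rewrite normrM ger0_norm // ler_wpM2l.
Qed.

Lemma generator_le : `|gen| <= (1 + Lam + Lam ^+ 2) * K.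
Proof.
have C0 := Creg_ge0.
have L0 : 0 <= Lam := step_size_ge0 Q HP.
have K0' : 0 <= K by rewrite mulr_ge0 // invr_ge0 exprn_ge0 // ltW.
have dt_le : `|F 1 t [::] x| <= K by apply: word_le.
have grad_le : `|dotv (mu_ a) (grad I phi t x)| <= Lam * K.
  apply: (@le_trans _ _ (l1norm (mu_ a) * K)).
    by apply: sum_l1_le => k; rewrite mxE; apply: (@word_le 3 0 t [:: k]).
  by rewrite ler_wpM2r // (drift_le Q N_ge1 HP).
have tr_le : `|\tr (sigma P t x a *m (sigma P t x a)^T *m hess I phi t x)| <= Lam ^+ 2 * K.
  rewrite trace_J2; apply: weighted => j.
  apply: (@le_trans _ _ (l1norm (noise a j) ^+ 2 * K)).
    by apply: dir_iter_le => w sw; apply: word_le => //; rewrite sw.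
  by rewrite ler_wpM2r // lerXn2r ?nnegrE ?l1norm_ge0 // (noise_le Q N_ge1 HP).
have := mulr_ge0 (exprn_ge0 2 L0) K0'; move: dt_le grad_le tr_le.
move=> /ler_normlP[? ?] /ler_normlP[? ?] /ler_normlP[? ?] ?.
apply/ler_normlP; split; lra.
Qed.

Variable phih : 'I_(nv m) -> R.
Hypothesis phihE : forall j b l, interp_vtx (y_ a j b) l -> phih l = phi T (vtx l).

Lemma row_expansion :
  `|\sum_j rho Q j / 2 * (Isp phih (y_ a j false) + Isp phih (y_ a j true))
     - phi t x - Dt * gen| <= Dt ^+ 2 * (pair_const Lam * K) + interp_const N Cp Cpatch Creg * H.
Proof.
have -> : \sum_j rho Q j / 2 * (Isp phih (y_ a j false) + Isp phih (y_ a j true))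
     - phi t x - Dt * gen = \sum_j rho Q j * ((Isp phih (y_ a j false)
       + Isp phih (y_ a j true) - 2 * (phi t x + Dt * D1) - Dt * J2 j) / 2).
  have E1 : \sum_j rho Q j * phi t x = phi t x by rewrite -mulr_suml (rho_sum HQ) mul1r.
  have E2 : \sum_j rho Q j * (Dt * D1 + Dt * (2^-1 * J2 j)) = Dt * gen.
    under eq_bigr do rewrite mulrDr.
    rewrite big_split -mulr_suml (rho_sum HQ) mul1r [RHS]mulrDr trace_J2 /=; congr (_ + _).
    by rewrite !mulr_sumr; apply: eq_bigr => j _; ring.
  rewrite -[X in _ - X - _ = _]E1 -[X in _ - X = _]E2 -!sumrB.
  by apply: eq_bigr => j _; field.
apply: weighted => j.
have pair := pair_consistency a j.
have ip := interp_consistency (@phihE j false).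
have im := interp_consistency (@phihE j true).
move: pair ip im => /ler_normlP[? ?] /ler_normlP[? ?] /ler_normlP[? ?].
apply/ler_normlP; split; lra.
Qed.

Let r0 : 0 <= rate P t x a. Proof. exact: ok_rate_ge0 HP _ _ _ t_times xcl. Qed.
Let rK : rate P t x a <= K0.
Proof.
have [_ _ + _] := coefficients_le N_ge1 HP a t_times xcl.
by rewrite ger0_norm.
Qed.

Lemma Sop_full : Sop P Q Nt n i a phih =
  (\sum_j rho Q j / 2 * (Isp phih (y_ a j false) + Isp phih (y_ a j true)))
    / (1 + rate P t x a * Dt) + source P t x a * Dt.
Proof.
have E : \sum_j rho Q j * (source P t x a * Dt) = source P t x a * Dt.
  by rewrite -mulr_suml (rho_sum HQ) mul1r.
rewrite /Sop mulr_suml -[X in _ = _ + X]E -big_split /=.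
apply: eq_bigr => j _; rewrite big_bool /= !full_omega !full_exit_time /branch_val !no_exit /=.
have d0 : 1 + rate P t x a * Dt != 0.
  by rewrite gt_eqF // ltr_pwDl // mulr_ge0.
by field.
Qed.

(** Discounting by [1 + rate * Dt] instead of subtracting [rate * phi] changes the
    residual by [rate * Dt] times the operator applied to [phi], and division by
    [tau = Dt] turns the interpolation error [h ^ 2 / eps] into
    [h ^ 2 / (Dt * eps)]. *)
Lemma residual_consistency :
  `|Res P Q Nt n i a (phi t x) phih - Fop P I a phi t x|
    <= row_const N Q K0 Cp Cpatch Creg * (Dt * eps ^- 3 + Dt ^+ 2 * eps ^- 5 + h ^+ 2 / Dt * eps^-1).
Proof.
have C0 := Creg_ge0; have L0 : 0 <= Lam := step_size_ge0 Q HP.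
have K0_ge0 : 0 <= K0 := ltW (ok_K0 HP).
have e3 : 1 <= eps ^- 3 by rewrite invf_ge1 ?exprn_gt0 // exprn_ile1 // ltW.
have K_ge : Creg <= K by rewrite -[leLHS]mulr1 ler_wpM2l.
have phx : `|phi t x| <= K.
  by apply: le_trans K_ge; exact: (sup_norm_le phi_le tI (row_ball_inner row_ball_center)).
have genK := generator_le; have rowK := row_expansion.
rewrite /Res full_tau Sop_full.
set S := \sum_j _ in rowK *.
set r := rate P t x a.
have -> : Fop P I a phi t x = gen - r * phi t x + source P t x a.
  by rewrite /Fop; congr (_ - _ + _); exact: addrAC.
set L := gen in genK rowK *.
set f := source P t x a.
have Dn0 : Dt != 0 by rewrite gt_eqF.
have d1 : 1 <= 1 + r * Dt by rewrite lerDl mulr_ge0.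
have dn0 : 1 + r * Dt != 0 by rewrite gt_eqF // (lt_le_trans ltr01 d1).
have -> : (S / (1 + r * Dt) + f * Dt - phi t x) / Dt - (L - r * phi t x + f)
    = ((S - phi t x - Dt * L) / Dt - r * Dt * (L - r * phi t x)) / (1 + r * Dt).
  by field; rewrite dn0 Dn0.
have e1 : `|(S - phi t x - Dt * L) / Dt| <= Dt * (pair_const Lam * K) + interp_const N Cp Cpatch Creg * (H / Dt).
  rewrite normrM normfV [`|Dt|]ger0_norm // ler_pdivrMr //.
  by apply: (le_trans rowK); rewrite le_eqVlt; apply/orP; left; apply/eqP; field;
    rewrite Dn0 gt_eqF.
have e2 : `|r * Dt * (L - r * phi t x)| <= K0 * Dt * ((1 + Lam + Lam ^+ 2 + K0) * K).
  rewrite normrM [`|r * Dt|](ger0_norm (mulr_ge0 r0 Dt_ge0)).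
  apply: ler_pM; [by rewrite mulr_ge0 | by [] | by rewrite ler_wpM2r |].
  rewrite [X in _ <= X]mulrDl; apply: (le_trans (ler_normB _ _)); apply: lerD => //.
  by rewrite normrM [`|r|]ger0_norm //; apply: ler_pM.
have pc0 : 0 <= pair_const Lam.
  by rewrite /pair_const !addr_ge0 // exprn_ge0.
have ic0 : 0 <= interp_const N Cp Cpatch Creg.
  by rewrite /interp_const mulr_ge0 // addr_ge0 // ?mulr_ge0 // exprn_ge0 // mulr_ge0.
have kc0 : 0 <= K0 * (1 + Lam + Lam ^+ 2 + K0).
  by rewrite mulr_ge0 // !addr_ge0 // exprn_ge0.
have rc0 : 0 <= Creg * (pair_const Lam + K0 * (1 + Lam + Lam ^+ 2 + K0)).
  by rewrite mulr_ge0 // addr_ge0.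
rewrite normrM normfV [X in _ / X]ger0_norm ?(le_trans ler01 d1) // ler_pdivrMr ?(lt_le_trans ltr01 d1) //.
apply: (le_trans (ler_normB _ _)); apply: (le_trans (lerD e1 e2)).
have T1 : 0 <= Dt * eps ^- 3 by rewrite mulr_ge0 // (le_trans ler01 e3).
have T2 : 0 <= Dt ^+ 2 * eps ^- 5.
  by rewrite mulr_ge0 ?exprn_ge0 // invr_ge0 exprn_ge0 // ltW.
have T3 : 0 <= h ^+ 2 / Dt * eps^-1.
  apply: mulr_ge0; last by rewrite invr_ge0 ltW.
  by apply: mulr_ge0; rewrite ?invr_ge0 // exprn_ge0 // meshsize_ge0.
apply: (@le_trans _ _ (row_const N Q K0 Cp Cpatch Creg * (Dt * eps ^- 3 + Dt ^+ 2 * eps ^- 5 + h ^+ 2 / Dt * eps^-1))).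
  rewrite /row_const /=.
  have -> : Dt * (pair_const Lam * K) + interp_const N Cp Cpatch Creg * (H / Dt)
      + K0 * Dt * ((1 + Lam + Lam ^+ 2 + K0) * K)
    = Creg * (pair_const Lam + K0 * (1 + Lam + Lam ^+ 2 + K0)) * (Dt * eps ^- 3)
      + interp_const N Cp Cpatch Creg * (h ^+ 2 / Dt * eps^-1) by ring.
  move: rc0 ic0 T1 T2 T3.
  move: (Creg * (_ + _)) (interp_const _ _ _ _) (Dt * _) (_ * eps ^- 5) (_ / Dt * _).
  move=> c1 c2 x1 x2 x3 c10 c20 x10 x20 x30.
  by have := (mulr_ge0 c10 x20, mulr_ge0 c10 x30, mulr_ge0 c20 x10, mulr_ge0 c20 x20); case=> -[] -[]; lra.
rewrite -[leLHS]mulr1 ler_wpM2l // mulr_ge0 //; first by rewrite /row_const addr_ge0.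
by rewrite !addr_ge0.
Qed.

End Control.
End Consistency.
End Row.

(** * The infimum over the controls and the theorem *)

(** If one of the ranges is bounded below then so is the other; if neither is,
    both infima are [0] by convention. *)
Lemma inf_range_close (R : realType) (T : Type) (f g : T -> R) (e : R) (a0 : T) :
  (forall a, `|f a - g a| <= e) -> `|inf (range f) - inf (range g)| <= e.
Proof.
move=> fg; have e0 : 0 <= e := le_trans (normr_ge0 _) (fg a0).
have tr (f1 g1 : T -> R) : (forall a, `|f1 a - g1 a| <= e) ->
    has_lbound (range f1) -> has_lbound (range g1).
  move=> fg1 [b fb]; exists (b - e) => _ [a _ <-].
  have := fb _ (imageT f1 a); have /ler_normlP[] := fg1 a; lra.
have le_inf1 (f1 g1 : T -> R) : (forall a, `|f1 a - g1 a| <= e) ->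
    has_lbound (range f1) -> inf (range f1) - e <= inf (range g1).
  move=> fg1 lb; apply: lb_le_inf; first by exists (g1 a0); exact: imageT.
  move=> _ [a _ <-].
  have := ge_inf lb (imageT f1 a); have /ler_normlP[] := fg1 a; lra.
have gf a : `|g a - f a| <= e by rewrite distrC.
have [lb|nlb] := pselect (has_lbound (range f)).
  have := le_inf1 _ _ gf (tr _ _ fg lb); have := le_inf1 _ _ fg lb.
  by move=> ? ?; apply/ler_normlP; split; lra.
rewrite !inf_out ?subrr ?normr0 //; last by move=> [].
by move=> [_ /(tr _ _ gf)].
Qed.

Theorem theorem5p5 (R : realType) (N p M : nat) (A : metricType R)
    (P : problem R N p A) (Q : cubature R p M) (K0 Cbd Cp Cpatch Creg : R)
    (N_ge1 : (1 <= N)%N) (p_ge1 : (1 <= p)%N) (M_ge1 : (1 <= M)%N)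
    (HP : problem_ok P K0) (HQ : cubature_ok Q)
    (Cbd_ge0 : 0 <= Cbd) (Cp_ge0 : 0 <= Cp) (Cpatch_ge0 : 0 <= Cpatch) :
  exists C : R,
  forall (m : mesh R N) (Nt : nat) (eps : R) (n : nat) (i : 'I_(nv m))
    (phi : R -> 'cV[R]_N -> R),
  let h := meshsize m in
  let Dt := dt P Nt in
  let I := `[tn P Nt n, tn P Nt n.+1]%classic in
  let Oeps := inner (dom P) eps in
  let err := C * (Dt * eps ^- 3 + Dt ^+ 2 * eps ^- 5 + h ^+ 2 / Dt * eps^-1) in
  mesh_ok P Q m Nt Cbd Cp Cpatch ->
  0 < Dt <= 1 -> 0 < eps <= 1 -> (n < Nt)%N ->
  smooth I Oeps phi ->
  (sup_norm Num.norm I Oeps phi <= Creg%:E)%E ->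
  (forall (alpha : {ffun 'I_N -> nat}) (q : nat),
     (1 <= msize alpha + 2 * q <= 6)%N ->
     (sup_norm Num.norm I Oeps (Dxt I alpha q phi)
        <= (Creg * eps ^ (1 - (msize alpha + 2 * q)%N%:Z))%:E)%E) ->
  dom P (vtx i) ->
  ((2 * eps + BC P Q * Num.sqrt Dt + Cpatch * h)%:E
     <= dist (vtx i) (bd (dom P)))%E ->
  (forall (a : A) (j : 'I_M) (b : bool),
     [/\ exit_time P Q Nt n i a j b = Dt,
         tau P Q Nt n i a = Dt,
         omega P Q Nt n i a j b = rho Q j / 2
       & forall y, interp_point P Q Nt n i a j b y ->
           ((2 * eps)%:E <= dist y (bd (dom P)))%E /\ Oeps y]) /\
  (forall phih : 'I_(nv m) -> R,
     (forall a j b l, interp_vtx (Gam P Q Nt n i a j b Dt) l ->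
        phih l = phi (tn P Nt n.+1) (vtx l)) ->
     (forall a : A,
        `| Res P Q Nt n i a (phi (tn P Nt n) (vtx i)) phih
           - Fop P I a phi (tn P Nt n) (vtx i) | <= err) /\
     `| Sres P Q Nt n i (phi (tn P Nt n) (vtx i)) phih
        - inf (range (fun a => Fop P I a phi (tn P Nt n) (vtx i))) | <= err).
Proof.
exists (row_const N Q K0 Cp Cpatch Creg) => m Nt eps n i phi h Dt I Oeps err.
move=> Hm Dt01 eps01 n_lt sm phi_le Dphi_le xO x_far.
have [_ [a0 _]] := ok_A HP.
split=> [a j b|phih phihE].
  split.
  - exact: (full_exit_time N_ge1 HP Cpatch_ge0 Dt01 eps01 n_lt xO x_far).
  - exact: (full_tau N_ge1 HP HQ Cpatch_ge0 Dt01 eps01 n_lt xO x_far).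
  - exact: (full_omega N_ge1 HP HQ Cpatch_ge0 Dt01 eps01 n_lt xO x_far).
  - by move=> y; exact: (interp_points_inner N_ge1 HP Cpatch_ge0 Hm Dt01 eps01 n_lt xO x_far).
have rows a : `|Res P Q Nt n i a (phi (tn P Nt n) (vtx i)) phih
    - Fop P I a phi (tn P Nt n) (vtx i)| <= err.
  exact: (residual_consistency N_ge1 M_ge1 HP HQ Cp_ge0 Cpatch_ge0 Hm Dt01 eps01 n_lt xO
    x_far sm phi_le Dphi_le (phihE a)).
by split=> //; apply: (inf_range_close a0).
Qed.
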